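(* Let the observable be $O=\sum_{k=1}^N o_kZ_k$ on $N$ qubits, where $Z_k$ is the Pauli matrix $Z$ on the $k$-th qubit and the identity on the other qubits. Let $V(\bm\theta)=\prod_{d=D}^{1}\exp[-iH_d\theta_d/2]$, where the Hamiltonian $H_d$ of the $d$-th gate acts on the qubits $\mathcal{S}_d\subseteq\{1,\dots,N\}$, $|\mathcal{S}_d|=S$, and is randomly sampled from $\mathcal{H}:=\{X,Y\}^{\otimes S}$; let $\mathcal{Q}:=\{\mathcal{S}_d\}$. For each sample $a$ of the training dataset $\mathcal{A}$ let $\rho_a=|\psi(\bm x_a)\rangle\langle\psi(\bm x_a)|$ be the density matrix of the qubit embedding $$|\psi(\bm x)\rangle=\bigotimes_{n=1}^N e^{-iZ\pi x_n/2}\,\frac{|0\rangle+|1\rangle}{\sqrt2}$$ of a vector $\bm x_a\in\mathbb{R}^N$, where each entry of $\bm x_a$ is an independent random variable distributed uniformly in $[-1,1]$. Let $K(\bm 0)$ be the quantum neural tangent kernel at $\bm\theta=\bm 0$, and let $$\Delta_S:=\min_{\bm g\in\{0,\pm1\}^N,\ 1\le\|\bm g\|_1\le S}(\bm g^T\bm o)^2 .$$ Then, when $|\mathcal{A}|$ is sufficiently large, there exist two constants $C_1,C_2>0$ such that for any $\delta,k\in(0,1)$, the following holds with probability at least $1-\delta$: every eigenvalue $\lambda[K(\bm 0)]$ of $K(\bm 0)$ satisfies $$(1-k)\frac{\Delta_S}{2^S}\ \le\ \lambda[K(\bm 0)]\ \le\ (1+k)\frac{\|O\|_2^2}{2^S},$$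 for $D\ge D_0\ln\frac{D_0}{\delta}$ with $D_0=C_2\frac{|\mathcal{A}|\,\|O\|_2^4}{k^2\Delta_S^2}\ln\frac{|\mathcal{A}|}{\delta}$ and $S\ge 2+\log_2\frac{C_1^2|\mathcal{A}|^2\ln|\mathcal{A}|}{k^2|\mathcal{Q}|\delta^2}$.
   Context: $\bm o=(o_1,\dots,o_N)^T\in\mathbb{R}^N$. The product $\prod_{d=D}^1$ has the factor $d=D$ leftmost. Random circuit: $\mathcal{Q}$ is a set of $S$-element subsets of $\{1,\dots,N\}$. The gates are chosen independently: $\mathcal{S}_d$ is uniform in $\mathcal{Q}$, and, given $\mathcal{S}_d$, $H_d$ is the tensor product of a uniformly random element of $\{X,Y\}^{\otimes S}$ on the qubits of $\mathcal{S}_d$ with the identity on the other qubits. The circuit is independent of the data, and the vectors $\bm x_a$ are independent for different $a$. Kernel: $z_a(\bm\theta)=\mathrm{Tr}[O V(\bm\theta)\rho_aV(\bm\theta)^\dagger]$, $J_{da}(\bm\theta)=\frac{\partial z_a}{\partial\theta_d}(\bm\theta)$, and the quantum neural tangent kernel is the $|\mathcal{A}|\times|\mathcal{A}|$ matrix $K(\bm\theta)=\frac1DJ(\bm\theta)^TJ(\bm\theta)$. $\|O\|_2$ is the spectral norm. Probability is over the random data and the random circuit. *)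

(* Defs.v *)
(* MathComp / MathComp-Analysis; the complex numbers are R[i]. *)
From HB Require Import structures.
From mathcomp Require Import all_boot all_order all_algebra.
From mathcomp Require Import complex.
From mathcomp Require Import all_classical all_reals all_analysis.

Set Implicit Arguments.
Unset Strict Implicit.
Unset Printing Implicit Defensive.

Import Order.TTheory GRing.Theory Num.Theory.
Import numFieldNormedType.Exports.

Local Open Scope classical_set_scope.
Local Open Scope ring_scope.
Local Open Scope complex_scope.
Local Open Scope sesquilinear_scope.

Section LinearAlgebra.
Variable R : realType.

Definition mexp n (A : 'M[R[i]]_n) : 'M[R[i]]_n :=
  limn (series (fun k : nat => k`!%:R^-1 *: A ^+ k)).

Definition l2norm n (v : 'cV[R[i]]_n) : R :=
  Num.sqrt (\sum_i complex.Re `|v i 0| ^+ 2).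

Definition spectral_norm n (A : 'M[R[i]]_n) : R :=
  sup [set l2norm (A *m v) | v in [set v : 'cV[R[i]]_n | l2norm v <= 1]].

End LinearAlgebra.

(* The computational basis of N qubits is indexed by the bit strings
   {ffun 'I_N -> 'I_2}, enumerated by bits; the space has dimension
   #|{ffun 'I_N -> 'I_2}| = 2 ^ N. *)
Notation hdim N := #|{: {ffun 'I_N -> 'I_2}}|.

Section Qubits.
Variables (R : realType) (N : nat).

Definition bits (i : 'I_(hdim N)) : {ffun 'I_N -> 'I_2} := enum_val i.

Definition tens_op (A : 'I_N -> 'M[R[i]]_2) : 'M[R[i]]_(hdim N) :=
  \matrix_(i, j) \prod_(n < N) A n (bits i n) (bits j n).

Definition tens_vec (v : 'I_N -> 'cV[R[i]]_2) : 'cV[R[i]]_(hdim N) :=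
  \col_i \prod_(n < N) v n (bits i n) 0.

Definition pauliX : 'M[R[i]]_2 := \matrix_(i, j) (i != j)%:R.
Definition pauliY : 'M[R[i]]_2 :=
  \matrix_(i, j) (if i == j then 0 else if i == 0 then - 'i else 'i).
Definition pauliZ : 'M[R[i]]_2 :=
  \matrix_(i, j) (if i == j then (-1) ^+ i else 0).

Definition Zat (k : 'I_N) : 'M[R[i]]_(hdim N) :=
  tens_op (fun n => if n == k then pauliZ else 1%:M).

Definition observable (o : 'cV[R]_N) : 'M[R[i]]_(hdim N) :=
  \sum_(k < N) (o k 0)%:C *: Zat k.

(* |+> = (|0> + |1>) / sqrt 2 *)
Definition ket_plus : 'cV[R[i]]_2 := const_mx ((Num.sqrt 2)^-1)%:C.

Definition embedding (x : 'I_N -> R) : 'cV[R[i]]_(hdim N) :=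
  tens_vec (fun n => mexp ((- 'i * (pi * x n / 2)%:C) *: pauliZ) *m ket_plus).

Definition density (x : 'I_N -> R) : 'M[R[i]]_(hdim N) :=
  embedding x *m (embedding x)^t*.

(* A gate Hamiltonian is encoded by a word giving, for each qubit, the
   identity (None), X (Some false) or Y (Some true); the set of qubits on which
   the gate acts is the support of the word. *)
Definition word := {ffun 'I_N -> option bool}.

Definition wsupp (w : word) : {set 'I_N} := finset (fun n => w n != None).

Definition hamiltonian (w : word) : 'M[R[i]]_(hdim N) :=
  tens_op (fun n => match w n with
                    | None => 1%:M
                    | Some false => pauliX
                    | Some true => pauliY
                    end).

Section Circuit.
Variables (D m : nat) (o : 'cV[R]_N) (w : 'I_D -> word)
  (x : 'I_m -> 'I_N -> R).

Definition gate (theta : 'rV[R]_D) (d : 'I_D) : 'M[R[i]]_(hdim N) :=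
  mexp ((- 'i * (theta 0 d / 2)%:C) *: hamiltonian (w d)).

(* rev_ord puts the last gate leftmost *)
Definition circuit (theta : 'rV[R]_D) : 'M[R[i]]_(hdim N) :=
  \prod_(d < D) gate theta (rev_ord d).

(* The trace is real, observable and density being Hermitian; Re only serves
   to land in R. *)
Definition output (a : 'I_m) (theta : 'rV[R]_D) : R :=
  complex.Re (\tr (observable o *m circuit theta *m density (x a)
                     *m (circuit theta)^t*)).

Definition qjacobian (theta : 'rV[R]_D) : 'M[R]_(D, m) :=
  \matrix_(d, a) 'D_(delta_mx 0 d) (output a) theta.

Definition qntk (theta : 'rV[R]_D) : 'M[R]_m :=
  D%:R^-1 *: ((qjacobian theta)^T *m qjacobian theta).

End Circuit.

(* For 1 <= S <= N the set is finite and nonempty, so this inf is a min. *)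
Definition Delta (S : nat) (o : 'cV[R]_N) : R :=
  inf [set (\sum_(n < N) (g n)%:~R * o n 0) ^+ 2 | g in
       [set g : 'I_N -> int | (forall n, g n \in [:: -1; 0; 1]) /\
                              (1 <= \sum_(n < N) `|g n| <= S%:Z)]].

End Qubits.

Lemma ltN11 (R : realType) : -1 < 1 :> R.
Proof. by rewrite -subr_gt0 opprK addr_gt0. Qed.

Section Randomness.
Context {R : realType} {disp : measure_display} {T : measurableType disp}.
Variable P : probability T R.

Definition mutually_independent (I : finType) (F : I -> set (set T)) :=
  forall (J : {set I}) (E : I -> set T), (forall i, F i (E i)) ->
    P (\bigcap_(i in [set` J]) E i) = (\prod_(i in J) P (E i))%E.

Definition uniform_on_m1_1 (X : {RV P >-> R}) :=
  forall A : set R, measurable A ->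
    distribution P X A = uniform_prob (ltN11 R) A.

Definition measurable_word N (W : T -> word N) :=
  forall w, measurable (W @^-1` [set w]).

(* The support is uniform in Q and, given the support, all of the 2 ^ S words
   over {X, Y} on it are equally likely. *)
Definition gate_law N (Q : {set {set 'I_N}}) (S : nat) (W : T -> word N) :=
  (forall s : {set 'I_N}, s \in Q ->
     P [set t | wsupp (W t) = s] = (#|Q|%:R^-1)%:E) /\
  (forall w : word N, wsupp w \in Q ->
     P [set t | W t = w] =
     (P [set t | wsupp (W t) = wsupp w] * ((2 ^+ S)^-1)%:E)%E).

(* sigma-algebras of the entries of the data vectors and of the gates *)
Definition sources m N D (X : 'I_m -> 'I_N -> {RV P >-> R})
    (W : 'I_D -> T -> word N) (i : 'I_m * 'I_N + 'I_D) : set (set T) :=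
  match i with
  | inl (a, n) => [set X a n @^-1` A | A in [set A : set R | measurable A]]
  | inr d => [set W d @^-1` B | B in [set: set (word N)]]
  end.

End Randomness.

Definition log2 {R : realType} (x : R) : R := ln x / ln 2.

(* Main.v *)
(* Let x = 2^S |Q| be the number of words that a gate can take, and let J_w(a) be
   the derivative at 0 of the output on sample a with respect to a gate w: a sum
   over k of o_k times a product of cosines and sines of pi x_n, that is, minus the
   derivative in the direction o of the product T_w(a) of these functions. Expanding
   each cosine and sine in exp(i t), exp(-i t), Parseval's identity writes, for every
   support s, both sum_w (sum_a v_a T_w(a))^2 and sum_w (sum_a v_a J_w(a))^2 as sums
   over the frequencies g in {-1,1}^s, the second one with the additional weights
   (g.o)^2. These lie between Delta and normO^2, so the expected kernel lies between
   Delta / 2^S and normO^2 / 2^S times the Gram matrix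
   G_ab = |Q|^-1 sum_w T_w(a) T_w(b).
   G has diagonal 1, and by orthogonality of the T_w its other entries have second
   moment 2^-S / |Q|; Markov's inequality gives G close to 1 in Frobenius norm.

   The kernel is sum_w (n_w / D) J_w J_w^T with n_w the number of gates equal to w,
   so no matrix concentration is needed: it is enough that every n_w be within a
   factor 1 +- k/4 of D / x, which follows from a scalar Chernoff bound as soon as D
   is at least of order x ln(x / delta) / k^2. Finally x <= 16 normO^4 / Delta^2:
   the subset sums of o over a family of sets with pairwise symmetric differences of
   size at most S are sqrt(Delta)-separated in an interval of length normO, which
   bounds the size of the family; apply this to the subsets of one support and to
   the sets of size at most S/2, three of which cover any support (for S = 1, use
   N <= normO / sqrt(Delta) instead). *)
Require Import Defs.
From HB Require Import structures.
From mathcomp Require Import all_boot all_order all_algebra.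
From mathcomp Require Import complex spectral ring lra zify.
From mathcomp Require Import all_classical all_reals all_analysis.

Set Implicit Arguments.
Unset Strict Implicit.
Unset Printing Implicit Defensive.

Import Order.TTheory GRing.Theory Num.Theory.
Import numFieldNormedType.Exports.

Local Open Scope classical_set_scope.
Local Open Scope ring_scope.

(** * Exponentials of involutions *)

Section MatrixExponential.
Variable R : realType.
Local Open Scope complex_scope.
Local Open Scope sesquilinear_scope.

Lemma cvgn_real_complex (u : R^nat) (l : R) (C := (R[i] : numFieldType)) :
  u @ \oo --> l -> (fun n => (u n)%:C : C) @ \oo --> (l%:C : C).
Proof.
move=> ul; apply/cvgrPdist_lt => -[e e'].
rewrite ltcE /= => /andP[/eqP -> e0].
move/cvgrPdist_lt : ul => /(_ e e0); apply: filterS => n.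
by rewrite -rmorphB /= normc_def /= expr0n addr0 sqrtr_sqr ltcR.
Qed.

(** The powers of an involution alternate between 1 and [A], so the exponential series splits into
    the series of cosine and sine. Pauli Z and all gate Hamiltonians are involutions. *)
Lemma mexp_involutive n (A : 'M[R[i]]_n) (r : R) : A * A = 1 ->
  mexp ((- 'i * r%:C) *: A) = (cos r)%:C *: 1%:M + (- 'i * (sin r)%:C) *: A.
Proof.
move=> AA; pose C := (R[i] : numFieldType).
apply: (@cvg_lim 'M[C]_n); first exact: (@norm_hausdorff C 'M[C]_n).
have Apow z k : (z *: A) ^+ k = z ^+ k *: if odd k then A else 1%:M.
  elim: k => [|k IH]; first by rewrite !expr0 scale1r.
  rewrite exprS IH -[_ * _]/(_ *m _) -scalemxAl -scalemxAr scalerA -exprS /=.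
  by case: (odd k) => /=; congr (_ *: _); [exact: AA | rewrite mulmx1].
have ipow k : (- 'i) ^+ k = (if odd k then - 'i else 1) * ((-1) ^+ k./2)%:C :> R[i].
  rewrite -{1}(odd_double_half k) exprD -mul2n exprM sqrrN sqr_i rmorphXn rmorphN1.
  by case: odd; rewrite ?expr1 ?expr0.
have -> : series (fun k : nat => k`!%:R^-1 *: ((- 'i * r%:C) *: A) ^+ k) =
    (fun k => (series (cos_coeff r) k)%:C *: (1%:M : 'M[R[i]]_n)
              + (series (sin_coeff r) k)%:C *: (- 'i *: A)).
  apply/funext => k; rewrite /series /= !rmorph_sum !scaler_suml -big_split /=.
  apply: eq_bigr => j _ /=; rewrite Apow exprMn ipow /cos_coeff /sin_coeff /=.
  rewrite !scalerA; case: (boolP (odd j)) => oj /=.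
    rewrite !mul0r rmorph0 scale0r add0r.
    have -> : j./2 = j.-1./2.
      case: (j) oj => [//|j' /=]; rewrite uphalfE => /negbTE h.
      by rewrite -(odd_double_half j') h add0n /= doubleK uphalf_double.
    rewrite !(rmorphM,rmorphXn,fmorphV,rmorph_nat,rmorph1,rmorphN1) /= mul1r; congr (_ *: _).
    by ring.
  rewrite mulr0n !mul0r scale0r addr0 -exprnP; congr (_ *: _).
  rewrite !(rmorphM,rmorphXn,fmorphV,rmorph_nat,rmorph1,rmorphN1) /= !mul1r.
  by ring.
rewrite [- 'i * _]mulrC -scalerA.
apply: cvgD; apply: cvgZr_tmp; apply: cvgn_real_complex.
  by rewrite cos.unlock; exact: is_cvg_series_cos_coeff.
by rewrite sin.unlock; exact: is_cvg_series_sin_coeff.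
Qed.
End MatrixExponential.

(** * Tensor products over the qubits *)

Section TensorProducts.
Variables (R : realType) (N : nat).
Local Open Scope complex_scope.
Local Open Scope sesquilinear_scope.
Local Notation C := (R[i]).

Lemma sum_bits (V : nmodType) (F : {ffun 'I_N -> 'I_2} -> V) :
  \sum_(i < hdim N) F (bits i) = \sum_f F f.
Proof.
rewrite (reindex (@enum_rank {ffun 'I_N -> 'I_2})) /=; last exact/onW_bij/enum_rank_bij.
by apply: eq_bigr => f _; rewrite /bits enum_rankK.
Qed.

Lemma sum_bits_prod (F : 'I_N -> 'I_2 -> C) :
  \sum_(i < hdim N) \prod_(n < N) F n (bits i n) = \prod_(n < N) \sum_c F n c.
Proof.
by rewrite (sum_bits (fun f => \prod_n F n (f n))) bigA_distr_bigA.
Qed.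

Lemma tens_op_mul (A B : 'I_N -> 'M[C]_2) :
  tens_op A *m tens_op B = tens_op (fun n => A n *m B n).
Proof.
apply/matrixP => i j; rewrite !mxE.
under eq_bigr do rewrite !mxE -big_split /=.
rewrite (sum_bits_prod (fun n c => A n (bits i n) c * B n c (bits j n))).
by apply: eq_bigr => n _; rewrite mxE.
Qed.

Lemma tens_op1 : tens_op (fun n => 1%:M) = 1%:M :> 'M[C]_(hdim N).
Proof.
apply/matrixP => i j; rewrite !mxE.
under eq_bigr do rewrite mxE.
case: eqVneq => [->|ij]; first by rewrite big1 // => n _; rewrite eqxx.
have /existsP[n nij] : [exists n, bits i n != bits j n].
  apply: contraNT ij => /existsPn h; apply/eqP/enum_val_inj/ffunP => n.
  exact/eqP/negPn/h.
by rewrite (bigD1 n) //= (negbTE nij) mul0r.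
Qed.

Lemma tens_op_adj (A : 'I_N -> 'M[C]_2) :
  (tens_op A)^t* = tens_op (fun n => (A n)^t*).
Proof.
apply/matrixP => i j; rewrite !mxE rmorph_prod.
by apply: eq_bigr => n _; rewrite !mxE.
Qed.

(** A sum over bit strings of a product over qubits is a product of sums, so product operators in
    product states have factored expectations. *)
Lemma tens_expect (A : 'I_N -> 'M[C]_2) (v : 'I_N -> 'cV[C]_2) :
  ((tens_vec v)^t* *m tens_op A *m tens_vec v) 0 0
  = \prod_n ((v n)^t* *m A n *m v n) 0 0.
Proof.
transitivity (\sum_j \prod_n ((\sum_c (v n c 0)^* * A n c (bits j n)) * v n (bits j n) 0)).
  rewrite mxE; apply: eq_bigr => j _; rewrite big_split [tens_vec v j 0]mxE /=.
  congr (_ * _); rewrite -sum_bits_prod mxE; apply: eq_bigr => i _.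
  by rewrite !mxE rmorph_prod -big_split.
rewrite (sum_bits_prod (fun n d => (\sum_c (v n c 0)^* * A n c d) * v n d 0)).
apply: eq_bigr => n _; rewrite mxE; apply: eq_bigr => d _; rewrite mxE.
by congr (_ * _); apply: eq_bigr => c _; rewrite !mxE.
Qed.

End TensorProducts.

(** * One-qubit expectations in the embedded state *)

Section Jacobian.
Variables (R : realType) (N : nat).
Local Open Scope complex_scope.
Local Open Scope sesquilinear_scope.
Local Notation C := (R[i]).

(** Expectations of 1, X and Y in the embedded qubit, at t = pi x; see [qexp_pauli]. *)
Definition trigf (c : option bool) (t : R) : R :=
  match c with None => 1 | Some false => cos t | Some true => sin t end.

(* Minus the derivative of trigf c. *)
Definition ndtrigf (c : option bool) (t : R) : R :=
  match c with None => 0 | Some false => sin t | Some true => - cos t end.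

Definition pauli (c : option bool) : 'M[C]_2 :=
  match c with None => 1%:M | Some false => pauliX R | Some true => pauliY R end.

Lemma pauli_sqr c : pauli c *m pauli c = 1%:M.
Proof.
apply/matrixP => i j; rewrite !mxE !big_ord_recl big_ord0.
case: c => [[]|] /=; rewrite !mxE;
  case: i => [[|[|//]] hi]; case: j => [[|[|//]] hj];
  rewrite /= ?mul0r ?mulr0 ?mul1r ?mulr1 ?add0r ?addr0 ?mulNr ?mulrN ?opprK -?expr2 ?sqr_i ?opprK //.
Qed.

Lemma pauli_adj c : (pauli c)^t* = pauli c.
Proof.
apply/matrixP => i j; rewrite !mxE.
case: c => [[]|] /=; rewrite ?mxE;
  case: i => [[|[|//]] hi]; case: j => [[|[|//]] hj] /=; rewrite ?conjC0 ?conjC1 //.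
  by rewrite complexiE ?rmorphN /= conjCi ?opprK.
  by rewrite complexiE ?rmorphN /= conjCi ?opprK.
Qed.

Lemma pauliZ_sqr : pauliZ R *m pauliZ R = 1%:M.
Proof.
apply/matrixP => i j; rewrite !mxE !big_ord_recl big_ord0 !mxE.
by case: i => [[|[|//]] hi]; case: j => [[|[|//]] hj];
  rewrite /= ?mulr0 ?mul0r ?addr0 ?add0r ?expr0 ?mulr1 ?expr1 ?mulrNN ?mulr1.
Qed.

Definition qubit (x : R) : 'cV[C]_2 :=
  mexp ((- 'i * (pi * x / 2)%:C) *: pauliZ R) *m ket_plus R.

Lemma qubitE x (t := pi * x / 2) (r := (Num.sqrt 2)^-1) :
  (qubit x 0 0 = (r * cos t) +i* (- (r * sin t))) *
  (qubit x 1 0 = (r * cos t) +i* (r * sin t)).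
Proof.
rewrite /qubit mexp_involutive; last exact: pauliZ_sqr.
split; rewrite !mxE !big_ord_recl big_ord0 !mxE /= -/t -/r;
  apply/eqP; rewrite eq_complex /=; apply/andP; split; apply/eqP; simpc; ring.
Qed.

Definition qexp (A : 'M[C]_2) x : C := ((qubit x)^t* *m A *m qubit x) 0 0.

Lemma qexpE (A : 'M[C]_2) x (q0 := qubit x 0 0) (q1 := qubit x 1 0) :
  qexp A x = (q0^* * A 0 0 + q1^* * A 1 0) * q0 + (q0^* * A 0 1 + q1^* * A 1 1) * q1.
Proof.
have l1 : lift ord0 ord0 = 1 :> 'I_2 by apply/val_inj.
rewrite /qexp /q0 /q1; move: (qubit x) => q.
by rewrite !mxE !big_ord_recl !big_ord0 !mxE !big_ord_recl !big_ord0 !l1 !mxE !addr0.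
Qed.

Let cos2 (t : R) : cos (t + t) = cos t * cos t - sin t * sin t.
Proof. by rewrite cosD. Qed.
Let sin2 (t : R) : sin (t + t) = 2 * (sin t * cos t).
Proof. by rewrite sinD; ring. Qed.
Let r2 : (Num.sqrt 2)^-1 * (Num.sqrt 2)^-1 = 2^-1 :> R.
Proof. by rewrite -invfM -expr2 sqr_sqrtr. Qed.

Lemma qexp_pauli c x : qexp (pauli c) x = (trigf c (pi * x))%:C.
Proof.
rewrite qexpE !qubitE.
set t := pi * x / 2; set r := _^-1.
have -> : pi * x = t + t by rewrite /t; lra.
(* Inserting the factor 2 r^2 = 1 on the right makes both sides polynomials in r, cos t and sin
   t. *)
have rr K : r * r * (2 * K) = K by rewrite r2 mulrA mulVf ?mul1r.
have one := cos2Dsin2 t.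
move: (cos2 t) (sin2 t) one rr; clearbody r; move: (cos t) (sin t) => u v c2 s2 one rr.
case: c => [[]|]; rewrite /= !mxE /= ?c2 ?s2;
  apply/eqP; rewrite eq_complex /=; apply/andP; split; apply/eqP; simpc; try ring.
- by rewrite -[RHS]rr; ring.
- by rewrite -[RHS]rr; ring.
by transitivity (r * r * (2 * (u ^+ 2 + v ^+ 2))); [ring | rewrite one rr].
Qed.

Lemma comm_pauliZ (A : 'M[C]_2) i j : (A *m pauliZ R - pauliZ R *m A) i j
  = A i j * ((-1) ^+ j - (-1) ^+ i).
Proof.
rewrite !mxE (bigD1 j) //= [X in _ + X - _]big1 => [|k kj]; last by rewrite !mxE (negbTE kj) mulr0.
rewrite (bigD1 i) //= [X in - (_ + X)]big1 => [|k ki].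
  by rewrite !mxE !eqxx /=; ring.
by rewrite !mxE eq_sym (negbTE ki) mul0r.
Qed.

(** From [X, Z] = - 2 i Y and [Y, Z] = 2 i X: the commutator with Z exchanges the two expectations
    up to sign, as differentiation does. *)
Lemma qexp_comm c x :
  qexp (pauli c *m pauliZ R - pauliZ R *m pauli c) x * 'i = (2 * ndtrigf c (pi * x))%:C.
Proof.
rewrite qexpE !qubitE !comm_pauliZ.
set t := pi * x / 2; set r := _^-1.
have -> : pi * x = t + t by rewrite /t; lra.
have rr K : r * r * (2 * K) = K by rewrite r2 mulrA mulVf ?mul1r.
move: (cos2 t) (sin2 t) rr; clearbody r; move: (cos t) (sin t) => u v c2 s2 rr.
rewrite /= !subrr !mulr0 add0r addr0 modn_small//.
have -> : (-1) ^+ 1 - (-1) ^+ 0 = (-2)%:C :> C by rewrite expr1 expr0 rmorphN rmorph_nat; ring.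
have -> : (-1) ^+ 0 - (-1) ^+ 1 = 2%:C :> C by rewrite expr1 expr0 rmorph_nat; ring.
case: c => [[]|]; rewrite /= !mxE /= ?c2 ?s2;
  apply/eqP; rewrite eq_complex /=; apply/andP; split; apply/eqP; simpc; try ring.

- by rewrite -[RHS]rr; ring.
- by rewrite -[RHS]rr; ring.
Qed.

End Jacobian.

(** * Gradient of the output at zero parameters *)

Lemma mxtrace_sandwich (F : comNzRingType) n (O H rho : 'M[F]_n) (p q r : F) :
  \tr (O *m (p *: 1%:M + q *: H) *m rho *m (p *: 1%:M + r *: H)) =
  p * p * \tr (O *m rho) + p * r * \tr (O *m rho *m H)
  + q * p * \tr (O *m H *m rho) + q * r * \tr (O *m H *m rho *m H).
Proof.
rewrite !mulmxDr -!scalemxAr !mulmx1 !mulmxDl -!scalemxAl.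
rewrite !mxtraceD !mxtraceZ !mxtraceD !mxtraceZ; ring.
Qed.

(** Linearity in the factor [k]; it confines the commutator with [Zat k] to that qubit. *)
Lemma tens_opB (R : realType) N (k : 'I_N) (A : 'I_N -> 'M[R[i]]_2) (X Y : 'M[R[i]]_2) :
  tens_op (fun n => if n == k then X else A n) - tens_op (fun n => if n == k then Y else A n)
  = tens_op (fun n => if n == k then X - Y else A n).
Proof.
apply/matrixP => i j; rewrite !mxE.
rewrite (bigD1 k) //= [X in _ - X](bigD1 k) //= [RHS](bigD1 k) //= !eqxx.
under eq_bigr => n /negbTE -> do []; under [X in _ - _ * X]eq_bigr => n /negbTE -> do [].
under [in RHS]eq_bigr => n /negbTE -> do [].
by rewrite !mxE mulrBl.
Qed.

Section Gradient.
Variables (R : realType) (N : nat).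
Local Open Scope complex_scope.
Local Open Scope sesquilinear_scope.
Local Notation C := (R[i]).

(** T_w of the overview: for phi = pi x, the expectation of the Hamiltonian of [w] in the embedded
    state. *)
Definition wfun (w : word N) (phi : 'I_N -> R) : R := \prod_n trigf (w n) (phi n).

(** J_w of the overview, with the product rule written out. *)
Definition wgrad (o : 'cV[R]_N) (w : word N) (phi : 'I_N -> R) : R :=
  \sum_k o k 0 * (ndtrigf (w k) (phi k) * \prod_(n | n != k) trigf (w n) (phi n)).

Lemma hamiltonianE (w : word N) : hamiltonian R w = tens_op (fun n => pauli R (w n)).
Proof. by []. Qed.

Lemma hamiltonian_sqr (w : word N) : hamiltonian R w * hamiltonian R w = 1.
Proof.
rewrite hamiltonianE -[LHS]/(_ *m _) tens_op_mul -[RHS](@tens_op1 R N); congr tens_op.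
by apply/funext => n; rewrite pauli_sqr.
Qed.

Lemma hamiltonian_adj (w : word N) : (hamiltonian R w)^t* = hamiltonian R w.
Proof.
rewrite hamiltonianE tens_op_adj; congr tens_op.
by apply/funext => n; rewrite pauli_adj.
Qed.

Variables (D m : nat) (o : 'cV[R]_N) (w : 'I_D -> word N) (x : 'I_m -> 'I_N -> R).

Definition rot (d : 'I_D) (h : R) : 'M[C]_(hdim N) :=
  (cos (h / 2))%:C *: 1%:M + (- 'i * (sin (h / 2))%:C) *: hamiltonian R (w d).

(** At angle 0 every gate other than [d] is the identity, so a single rotation is left of the
    ordered product. *)
Lemma circuit_line (d : 'I_D) (h : R) : circuit w (h *: delta_mx 0 d) = rot d h.
Proof.
have gE d' : gate w (h *: delta_mx 0 d) d' = if d' == d then rot d h else 1.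
  rewrite /gate (mexp_involutive _ (hamiltonian_sqr _)) !mxE eqxx /=.
  case: eqVneq => [->|_]; first by rewrite mulr1.
  by rewrite mulr0 mul0r cos0 sin0 mulr0 scale0r addr0 scale1r.
rewrite /circuit; under eq_bigr do rewrite gE.
rewrite -big_mkcond /= (big_pred1 (rev_ord d)) ?eqxx ?rev_ordK ?eqxx// => d' /=.
by rewrite (can2_eq (@rev_ordK _) (@rev_ordK _)).
Qed.

Lemma rot_adj d h : (rot d h)^t* =
  (cos (h / 2))%:C *: 1%:M + ('i * (sin (h / 2))%:C) *: hamiltonian R (w d).
Proof.
rewrite /rot linearD /= map_mxD !linearZ /= !map_mxZ hamiltonian_adj trmx1 map_mx1.
have e (r : R) : (r%:C)^*%R = r%:C.
  by rewrite conj_Creal // complex_real.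
congr (_ *: _ + _ *: _); first exact: e.
by apply/eqP; rewrite eq_complex /=; apply/andP; split; apply/eqP; simpc.
Qed.

Definition comm_exp (a : 'I_m) (d : 'I_D) : C :=
  \tr ((hamiltonian R (w d) *m observable o - observable o *m hamiltonian R (w d))
        *m density (x a)).


(** Conjugation by cos (h / 2) - i sin (h / 2) H gives a quadratic form in the cosine and sine,
    whose cross term is the expectation of a commutator. [B] may stay anonymous: its factor sin^2
    has zero derivative at 0. *)
Lemma output_line a d : exists B, forall h, output o w x a (h *: delta_mx 0 d) =
  cos (h / 2) ^+ 2 * output o w x a 0 + sin (h / 2) ^+ 2 * B
  + cos (h / 2) * sin (h / 2) * complex.Re ('i * comm_exp a d).
Proof.
pose H := hamiltonian R (w d); pose O := observable o; pose rho := density (x a).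
exists (complex.Re (\tr (O *m H *m rho *m H))) => h.
have c0 : circuit w 0 = 1%:M :> 'M[C]_(hdim N).
  have := circuit_line d 0; rewrite scale0r => ->.
  by rewrite /rot mul0r cos0 sin0 mulr0 scale0r addr0 scale1r.
rewrite /output circuit_line rot_adj c0 trmx1 map_mx1 !mulmx1 /rot -/H -/O -/rho /comm_exp -/H -/O -/rho.
set c := cos _; set s := sin _.
rewrite mulmxBl linearB /= -[H *m O *m rho]mulmxA [\tr (H *m (O *m rho))]mxtrace_mulC.
rewrite mxtrace_sandwich.
move: (\tr (O *m rho)) (\tr (O *m rho *m H)) (\tr (O *m H *m rho)) (\tr (O *m H *m rho *m H)) => t1 t2 t3 t4.
case: t1 => t1 t1'; case: t2 => t2 t2'; case: t3 => t3 t3'; case: t4 => t4 t4'.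
by simpc => /=; ring.
Qed.


(** Only the factor at qubit [k] fails to commute with [Zat k], so each term of the observable
    replaces one factor of the product by its commutator expectation: this is the product rule in
    [wgrad]. *)
Lemma comm_expE a d :
  complex.Re ('i * comm_exp a d) = 2 * wgrad o (w d) (fun n => pi * x a n).
Proof.
pose v n := qubit (x a n).
have trE (M : 'M[C]_(hdim N)) : \tr (M *m density (x a)) = ((tens_vec v)^t* *m M *m tens_vec v) 0 0.
  by rewrite mulmxA mxtrace_mulC /mxtrace big_ord1 mulmxA.
have -> : 'i * comm_exp a d = (2 * wgrad o (w d) (fun n => pi * x a n))%:C; last by [].
rewrite /comm_exp /observable mulmx_sumr mulmx_suml -sumrB mulmx_suml raddf_sum mulr_sumr /=.
rewrite /wgrad mulr_sumr rmorph_sum /=; apply: eq_bigr => k _.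
rewrite -scalemxAl -scalemxAr -scalerBr -scalemxAl mxtraceZ.
have -> : hamiltonian R (w d) *m Zat R k - Zat R k *m hamiltonian R (w d) =
    tens_op (fun n => if n == k then pauli R (w d k) *m pauliZ R - pauliZ R *m pauli R (w d k)
                      else pauli R (w d n)).
  rewrite hamiltonianE /Zat !tens_op_mul -tens_opB; congr (tens_op _ - tens_op _);
    by apply/funext => n; case: eqVneq => [->|_]; rewrite ?mulmx1 ?mul1mx.
rewrite trE tens_expect (bigD1 k) //= eqxx.
have -> : \prod_(n | n != k) ((v n)^t* *m
      (if n == k then pauli R (w d k) *m pauliZ R - pauliZ R *m pauli R (w d k)
       else pauli R (w d n)) *m v n) 0 0
   = (\prod_(n < N | n != k) trigf (w d n) (pi * x a n))%:C.
  by rewrite rmorph_prod; apply: eq_bigr => n /negbTE ->; exact: qexp_pauli.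
have := qexp_comm (w d k) (x a k); rewrite /qexp -/(v k); move: (_ 0 0) => q hq.
set p := \prod_(n < N | _) _; transitivity ((o k 0)%:C * p%:C * (q * 'i)); first by ring.
by rewrite hq -!rmorphM; congr (_%:C); ring.
Qed.

Lemma qjacobianE : qjacobian o w x 0 = \matrix_(d, a) wgrad o (w d) (fun n => pi * x a n).
Proof.
apply/matrixP => d a; rewrite !mxE.
have [B fB] := output_line a d.
set A := output o w x a 0 in fB; rewrite comm_expE in fB; set G := wgrad _ _ _ in fB *.
(* The half-angle terms of [output_line] rewritten in the full angle; the derivative of [g] at 0 is
   [G]. *)
pose g : R -> R := cst ((A + B) / 2) + ((A - B) / 2) \*: @cos R + G \*: @sin R.
have gE h : output o w x a (h *: delta_mx 0 d) = g h.
  have hh : h = h / 2 + h / 2 by lra.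
  have ch : cos h = cos (h / 2) * cos (h / 2) - sin (h / 2) * sin (h / 2) by rewrite -cosD -hh.
  have sh : sin h = sin (h / 2) * cos (h / 2) + cos (h / 2) * sin (h / 2) by rewrite -sinD -hh.
  rewrite fB /g !fctE /= /GRing.scale /= ch sh.
  move: (cos2Dsin2 (h / 2)); move: (cos _) (sin _) => c s cs.
  have -> : (A + B) / 2 = (A + B) / 2 * (c ^+ 2 + s ^+ 2) by rewrite cs mulr1.
  by field.
have -> : 'D_(delta_mx 0 d) (output o w x a) 0 = 'D_1 g (0 : R).
  rewrite /derive; suff -> : (fun h : R =>
      h^-1 *: ((output o w x a \o shift 0) (h *: delta_mx 0 d) - output o w x a 0))
    = (fun h : R => h^-1 *: ((g \o shift 0) (h *: 1) - g 0)) by [].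
  by apply/funext => h /=; rewrite !addr0 scaler1 -!gE scale0r.
by rewrite derive_val cos0 sin0 oppr0 scaler0 !add0r scaler1.
Qed.
End Gradient.

(** * Separation of subset sums *)

Section Combinatorics.
Variables (R : realType) (N : nat).
Implicit Types (o : 'cV[R]_N) (S : nat).

(** This is the spectral norm of the observable, by [spectral_normE]. *)
Definition absum o : R := \sum_n `|o n 0|.

(** Pigeonhole: [g] is the index of the cell of width eta that contains the value, and two values in
    one cell would be less than eta apart. *)
Lemma card_separated (I : finType) (A : {set I}) (v : I -> R) (l u eta : R) :
  0 < eta -> l <= u -> (forall i, l <= v i <= u) ->
  (forall i j, i \in A -> j \in A -> i != j -> eta <= `|v i - v j|) ->
  (#|A|%:R - 1) * eta <= u - l.
Proof.
move=> eta0 lu vlu vsep.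
pose g i := Num.truncn ((v i - l) / eta).
have vl0 i : 0 <= (v i - l) / eta.
  by apply: divr_ge0; [rewrite subr_ge0; case/andP: (vlu i) | exact: ltW].
have gM i : (g i < (Num.truncn ((u - l) / eta)).+1)%N.
  rewrite ltnS /g; apply: le_truncn.
  by rewrite ler_pM2r ?invr_gt0// lerD2r; case/andP: (vlu i).
have ginj : {in A &, injective (fun i => Ordinal (gM i))}.
  move=> i j iA jA /(congr1 val) /= gij; apply/eqP; apply: contraT => /(vsep _ _ iA jA).
  have /andP[a1 a2] := truncn_itv (vl0 i).
  have /andP[b1 b2] := truncn_itv (vl0 j).
  rewrite leNgt => /negP[]; rewrite -(ltr_pM2r (x := eta^-1)) ?invr_gt0// mulfV ?gt_eqF//.
  rewrite -[X in _ * X]gtr0_norm ?invr_gt0// -normrM.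
  move: a1 a2 b1 b2; rewrite -!/(g _) gij.
  rewrite ltr_norml !mulrBl => a1 a2 b1 b2; rewrite -natr1 in a2 b2.
  by apply/andP; split; lra.
have h : (#|A| <= (Num.truncn ((u - l) / eta)).+1)%N.
  by rewrite -(card_in_imset ginj) -[leqRHS]card_ord max_card.
rewrite -ler_pdivlMr//.
have ul0 : 0 <= (u - l) / eta by rewrite divr_ge0 ?subr_ge0// ltW.
have /andP[h1 _] := truncn_itv ul0.
apply: le_trans h1; rewrite lerBlDr natr1 ler_nat; exact: h.
Qed.

Lemma Delta_le S o (g : 'I_N -> int) : (forall n, g n \in [:: -1; 0; 1]) ->
  1 <= \sum_(n < N) `|g n| <= S%:Z -> 
  Delta S o <= (\sum_(n < N) (g n)%:~R * o n 0) ^+ 2.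
Proof.
move=> g1 gS; apply: ge_inf; last by exists g.
by exists 0 => _ [h _ <-]; exact: sqr_ge0.
Qed.


(** The difference of two subset sums is a signed sum over the symmetric difference, which is
    nonempty and has at most S elements; hence it is at least sqrt Delta in absolute value. *)
Lemma card_family_Delta S o (F : {set {set 'I_N}}) : 0 < Delta S o ->
  (forall A B, A \in F -> B \in F -> (#|A :\: B| + #|B :\: A| <= S)%N) ->
  (#|F|%:R - 1) * Num.sqrt (Delta S o) <= absum o.
Proof.
move=> D0 FS.
(* The least and the greatest subset sum: all negative entries, and all positive ones. *)
pose l := \sum_n Num.min (o n 0) 0; pose u := \sum_n Num.max (o n 0) 0.
have -> : absum o = u - l.
  rewrite /absum /u /l -sumrB; apply: eq_bigr => n _.
  by case: (leP (o n 0) 0) => h; rewrite ?(ler0_norm h) ?(gtr0_norm h); lra.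
pose v (A : {set 'I_N}) := \sum_(n in A) o n 0.
apply: (@card_separated _ _ v); first by rewrite sqrtr_gt0.
- by apply: ler_sum => n _; case: (leP (o n 0) 0) => h //; exact: ltW.
- move=> A; rewrite /v !(big_mkcond (fun n => n \in A)) /=; apply/andP; split;
    apply: ler_sum => n _; case: ifP => _; rewrite ?ge_min ?le_max ?lexx ?orbT//.
move=> A B AF BF AB.
pose g n : int := (n \in A)%:R - (n \in B)%:R.
have gP n : g n \in [:: -1; 0; 1] by rewrite /g; do 2 case: (_ \in _).
have -> : v A - v B = \sum_n (g n)%:~R * o n 0.
  rewrite /v !(big_mkcond (fun n => n \in _)) /= -sumrB; apply: eq_bigr => n _.
  by rewrite /g; do 2 case: (_ \in _); rewrite ?subrr ?mul0r ?subr0 ?mul1r ?sub0r ?mulN1r.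
have gS : \sum_n `|g n| = (#|A :\: B| + #|B :\: A|)%N%:Z.
  rewrite -!sum1_card PoszD !(big_mkcond (fun n => n \in _ :\: _)) /=.
  rewrite !(big_morph Posz PoszD (erefl (Posz 0))) -big_split /=.
  by apply: eq_bigr => n _; rewrite !inE /g; do 2 case: (_ \in _).
rewrite -(sqrtr_sqr (\sum_n _)) ler_sqrt ?sqr_ge0//.
apply: Delta_le => //; rewrite gS !lez_nat FS// andbT addn_gt0.
have : A :!=: B by []; rewrite finset.eqEsubset -!finset.setD_eq0 negb_and.
by rewrite -!card_gt0.
Qed.

End Combinatorics.

(** * Bound on the number of gate words *)

Section CountingSupports.
Variables (R : realType) (N S : nat) (Q : {set {set 'I_N}}) (o : 'cV[R]_N).
Hypothesis Q0 : Q != finset.set0.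
Hypothesis QS : forall s, s \in Q -> #|s| = S.
Hypothesis D0 : 0 < Delta S o.

(** For S = 0 the infimum runs over the empty set, where it is 0 by convention, contrary to [D0]. *)
Lemma support_size_gt0 : (0 < S)%N.
Proof.
rewrite lt0n; apply: contraTneq D0 => ->.
rewrite /Delta; set A := (X in inf X).
have -> : A = set0; last by rewrite inf0 ltxx.
apply/seteqP; split => [z [g [_ /andP[g1 g2]] _]|z []].
by have := le_trans g1 g2.
Qed.

Local Notation y := (absum o / Num.sqrt (Delta S o)).

Lemma card_family_ratio (F : {set {set 'I_N}}) :
  (forall A B, A \in F -> B \in F -> (#|A :\: B| + #|B :\: A| <= S)%N) ->
  #|F|%:R - 1 <= y.
Proof.
by move=> FS; rewrite ler_pdivlMr ?sqrtr_gt0//; exact: card_family_Delta.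
Qed.

Lemma card_subsets (s : {set 'I_N}) : s \in Q -> 2 ^+ S - 1 <= y.
Proof.
move=> sQ; have := @card_family_ratio (powerset s) _; rewrite card_powerset QS// natrX; apply.
move=> A B; rewrite !inE => As Bs; rewrite -cardsUI.
have -> : (A :\: B) :&: (B :\: A) = finset.set0.
  by apply/setP => n; rewrite !inE; case: (n \in A); case: (n \in B).
rewrite cards0 addn0 -(QS sQ) subset_leq_card//; apply/fintype.subsetP => n.
by rewrite !inE => /orP[] /andP[_]; [exact: (fintype.subsetP As) | exact: (fintype.subsetP Bs)].
Qed.

Lemma one_le_ratio : 1 <= y.
Proof.
have [s sQ] : exists s, s \in Q by apply/set0Pn.
apply: le_trans (card_subsets sQ); rewrite lerBrDr.
have := support_size_gt0; case: S => // S' _; rewrite exprS.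
have : 1 <= (2 : R) ^+ S' by rewrite exprn_ege1// ler1n.
by lra.
Qed.

(** The indicator of [n] is admissible in [Delta]. *)
Lemma sqrt_Delta_le_coord n : Num.sqrt (Delta S o) <= `|o n 0|.
Proof.
rewrite -sqrtr_sqr ler_sqrt ?sqr_ge0//.
have e : \sum_n0 `|(n0 == n)%:R : int| = 1.
  by rewrite (bigD1 n) //= eqxx big1 ?addr0 // => i /negbTE ->.
have <- : \sum_(n0 < N) (((n0 == n)%:R : int)%:~R * o n0 0) = o n 0.
  rewrite (bigD1 n) //= eqxx mul1r big1 ?addr0// => i /negbTE ->.
  by rewrite mul0r.
apply: Delta_le; first by move=> i; case: (i == n).
by rewrite e lexx /=; exact: support_size_gt0.
Qed.

Lemma card_qubits_ratio : N%:R <= y.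
Proof.
rewrite ler_pdivlMr ?sqrtr_gt0// /absum mulrC -[X in _ * X%:R]card_ord -sum1_card natr_sum mulr_sumr.
by apply: ler_sum => n _; rewrite mulr1; exact: sqrt_Delta_le_coord.
Qed.

(** Two blocks of half the size, rounded down, leave at most one element; this remainder is at most
    half of [s] because [s] has at least two elements. *)
Lemma split_in_three (s : {set 'I_N}) : (1 < #|s|)%N ->
  exists A B C : {set 'I_N}, s = A :|: B :|: C /\
   [/\ (#|A|.*2 <= #|s|)%N, (#|B|.*2 <= #|s|)%N & (#|C|.*2 <= #|s|)%N].
Proof.
pose e := enum s; pose h := #|s|./2; move=> s1.
exists [set x in take h e], [set x in take h (drop h e)], [set x in drop h (drop h e)].
split.
  apply/setP => x; rewrite !inE -orbA -!mem_cat; do 2 rewrite cat_take_drop.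
  by rewrite mem_enum.
have se : size e = #|s| by rewrite -cardE.
have hs (t : seq 'I_N) : ((size t).*2 <= #|s|)%N -> (#|[set x in t]|.*2 <= #|s|)%N.
  by apply: leq_trans; rewrite leq_double cardsE card_size.
by split; apply: hs; rewrite ?size_take ?size_drop se /h; [case: ifP|case: ifP|]; lia.
Qed.

Lemma card_support_ratio : #|Q|%:R <= (y + 1) ^+ 3.
Proof.
have y1 := one_le_ratio.
have [S1|S1] := leqP S 1.
  have S1' : S = 1%N by apply/eqP; rewrite eqn_leq S1 support_size_gt0.
  have : (#|Q| <= N)%N.
    have sub : Q \subset (@finset.set1 _) @: finset.setTfor 'I_N.
      apply/fintype.subsetP => s /QS; rewrite S1' => /eqP/cards1P[n ->].
      by apply/imsetP; exists n; rewrite ?inE.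
    by apply: leq_trans (subset_leq_card sub) _; rewrite -[leqRHS]card_ord -cardsT leq_imset_card.
  rewrite -(ler_nat R) => /le_trans; apply; apply: le_trans card_qubits_ratio _.
  by rewrite !exprS expr0; nra.
(* Two sets of size at most S / 2 have a symmetric difference of size at most S, so the separation
   bound applies to [F], and triples from [F] cover all supports. *)
pose F : {set {set 'I_N}} := finset.finset (fun A : {set 'I_N} => #|A|.*2 <= S)%N.
have yF : #|F|%:R <= y + 1.
  rewrite -lerBlDr; apply: card_family_ratio => A B; rewrite !inE => hA hB.
  have := subset_leq_card (subsetDl A B); have := subset_leq_card (subsetDl B A); lia.
have sub : Q \subset (fun t : {set 'I_N} * {set 'I_N} * {set 'I_N} => t.1.1 :|: t.1.2 :|: t.2)
    @: finset.setX (finset.setX F F) F.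
  apply/fintype.subsetP => s sQ; have := QS sQ => cs.
  have [|A [B [C [es []]]]] := @split_in_three s; first by rewrite cs.
  rewrite cs es => hA hB hC; apply/imsetP; exists (A, B, C) => //.
  by rewrite !inE /= hA hB hC.
have := leq_trans (subset_leq_card sub) (leq_imset_card _ _).
rewrite !cardsX -(ler_nat R) => /le_trans; apply.
by rewrite !natrM exprS expr2 mulrA; apply: ler_pM; rewrite ?mulr_ge0// ler_pM.
Qed.

(* The pigeonhole principle forces Delta to be exponentially small, which is what
   lets D0, in which 2 ^ S does not appear, control the number of gate words. *)
Lemma card_words_ratio : 2 ^+ S * #|Q|%:R <= 16 * y ^+ 4.
Proof.
have y1 := one_le_ratio.
have [s /card_subsets hs] : exists s, s \in Q by apply/set0Pn.
have h1 : 2 ^+ S <= 2 * y by lra.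
have h2 : (y + 1) ^+ 3 <= (2 * y) ^+ 3 by rewrite lerXn2r ?nnegrE; lra.
have -> : 16 * y ^+ 4 = (2 * y) * (2 * y) ^+ 3 by ring.
have e0 : 0 <= (2 : R) ^+ S by rewrite exprn_ge0.
exact: ler_pM e0 (ler0n _ _) h1 (le_trans card_support_ratio h2).
Qed.

End CountingSupports.

(** * Spectral norm of the observable *)

Section SpectralNorm.
Variables (R : realType) (N : nat) (o : 'cV[R]_N).
Local Open Scope complex_scope.
Local Notation C := (R[i]).

(** The eigenvalue of the observable on the basis state [f]. *)
Definition zeig (f : {ffun 'I_N -> 'I_2}) : R := \sum_k o k 0 * (-1) ^+ (f k).

Lemma observableE : observable o = diag_mx (\row_i (zeig (bits i))%:C).
Proof.
apply/matrixP => i j; rewrite /observable summxE !mxE.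
rewrite rmorph_sum -sumrMnl; apply: eq_bigr => k _; rewrite !mxE (bigD1 k) //= eqxx mxE.
case: (eqVneq i j) => [->|ij].
  rewrite eqxx big1 => [|n /negbTE ->]; last by rewrite mxE eqxx.
  by rewrite mulr1 mulr1n rmorphM rmorphXn rmorphN1.
rewrite mulr0n; apply/eqP; rewrite mulf_eq0; apply/orP; right.
have /existsP[n nij] : [exists n, bits i n != bits j n].
  apply: contraNT ij => /existsPn h; apply/eqP/enum_val_inj/ffunP => n.
  exact/eqP/negPn/h.
have [nk|nk] := eqVneq n k; first by rewrite -nk (negbTE nij) mul0r.
by rewrite (bigD1 n) //= (negbTE nk) mxE (negbTE nij) mul0r mulr0.
Qed.

Lemma zeig_le f : `|zeig f| <= absum o.
Proof.
apply: le_trans (ler_norm_sum _ _ _) _; apply: ler_sum => k _.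
by rewrite normrM normrX normrN1 expr1n mulr1.
Qed.

Lemma observable_mulE (v : 'cV[C]_(hdim N)) i :
  (observable o *m v) i 0 = (zeig (bits i))%:C * v i 0.
Proof. by rewrite observableE mul_diag_mx !mxE. Qed.

Lemma normsqE (z : C) : complex.Re `|z| ^+ 2 = complex.Re z ^+ 2 + complex.Im z ^+ 2.
Proof. by case: z => a b; rewrite /= sqr_sqrtr ?addr_ge0 ?sqr_ge0. Qed.

Lemma normsq_scale (r : R) (z : C) :
  complex.Re `|r%:C * z| ^+ 2 = r ^+ 2 * complex.Re `|z| ^+ 2.
Proof.
rewrite (normsqE (r%:C * z)) (normsqE z).
by case: z => a b; simpc => /=; ring.
Qed.

Lemma l2norm_observable v : l2norm (observable o *m v) <= absum o * l2norm v.
Proof.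
have a0 : 0 <= absum o by apply: sumr_ge0.
rewrite /l2norm -(ler_pXn2r (n := 2)) ?nnegrE ?mulr_ge0 ?sqrtr_ge0//.
have S0 (u : 'cV[C]_(hdim N)) : 0 <= \sum_i complex.Re `|u i 0| ^+ 2.
  by apply: sumr_ge0 => i _; rewrite sqr_ge0.
rewrite exprMn !sqr_sqrtr// mulr_sumr; apply: ler_sum => i _.
rewrite observable_mulE normsq_scale ler_wpM2r ?sqr_ge0//.
by rewrite -[X in X <= _]real_normK ?num_real// lerXn2r ?nnegrE// zeig_le.
Qed.

Lemma spectral_normE : spectral_norm (observable o) = absum o.
Proof.
have a0 : 0 <= absum o by apply: sumr_ge0.
rewrite /spectral_norm; set A := (X in sup X).
have ubA : ubound A (absum o).
  move=> _ [v /= v1 <-]; apply: le_trans (l2norm_observable v) _.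
  by rewrite ler_piMr.
(* Bits chosen to make every term of [zeig f] nonnegative, so that the basis state of [f] attains
   the norm. *)
pose f : {ffun 'I_N -> 'I_2} := [ffun k => if o k 0 < 0 then 1 else 0].
pose v : 'cV[C]_(hdim N) := delta_mx (enum_rank f) 0.
have fE : zeig f = absum o.
  apply: eq_bigr => k _; rewrite ffunE; case: (ltP (o k 0) 0) => h /=.
    by rewrite ltr0_norm// modn_small// expr1 mulrN1.
  by rewrite ger0_norm// mulr1.
have l2v (r : R) : l2norm (r%:C *: v) = `|r|.
  rewrite /l2norm (bigD1 (enum_rank f)) // big1 => [|i ne].
    by rewrite !mxE !eqxx mulr1 normsqE /= expr0n !addr0 sqrtr_sqr.
  by rewrite !mxE (negbTE ne) mulr0 normsqE /= expr0n addr0.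
have Ov : observable o *m v = (absum o)%:C *: v.
  apply/matrixP => i j; rewrite !ord1 observable_mulE !mxE.
  case: eqVneq => [->|_]; last by rewrite !mulr0.
  by rewrite /bits enum_rankK fE.
have Av : A (absum o).
  exists v; first by rewrite /= -[v]scale1r (l2v 1) normr1.
  by rewrite Ov l2v ger0_norm.
apply/eqP; rewrite eq_le; apply/andP; split.
  by apply: ge_sup => //; exists (absum o).
by apply: ub_le_sup => //; exists (absum o).
Qed.

End SpectralNorm.

(** * Fourier expansion of the word functions *)

Section Parseval.
Variables (R : realType) (N : nat).
Local Open Scope complex_scope.
Local Notation C := (R[i]).

(* The words of support s index both the gates on s and the frequencies in
   {-1, 1}^s, Some true standing for the frequency -1. *)
Definition freq (c : option bool) : int :=
  match c with None => 0 | Some false => 1 | Some true => -1 end.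

(** Having support [s] is a condition on each letter separately; in this form a sum over the words
    of support [s] distributes over the qubits. *)
Definition has_supp (s : {set 'I_N}) (n : 'I_N) : pred (option bool) :=
  fun c => (c != None) == (n \in s).

Lemma has_suppP s (w : word N) : (w \in family (has_supp s)) = (wsupp w == s).
Proof.
apply/familyP/eqP => [h|<- n]; last by rewrite unfold_in /has_supp inE.
by apply/setP => n; rewrite inE; have := h n; rewrite unfold_in => /eqP.
Qed.

Lemma sum_word_prod (V : comNzRingType) (s : {set 'I_N}) (F : 'I_N -> option bool -> V) :
  \sum_(w | wsupp w == s) \prod_n F n (w n) =
  \prod_n (if n \in s then F n (Some false) + F n (Some true) else F n None).
Proof.
rewrite (eq_bigl _ _ (fun w => esym (has_suppP s w))).
rewrite -bigA_distr_big_dep; apply: eq_bigr => n _.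
rewrite big_mkcond /= (bigD1 None) // (bigD1 (Some false)) // (bigD1 (Some true)) //= big1; last first.
  by case=> [[]|].
rewrite /has_supp /=; case: (n \in s); rewrite /= ?add0r ?addr0 //.
Qed.


Definition phase (c : option bool) (t : R) : C :=
  match c with None => 1 | Some false => cos t +i* sin t | Some true => cos t +i* - sin t end.

(* The coordinates of cos and sin in the basis exp(i t), exp(- i t); up to a
   factor 2^(-1/2) they form a unitary matrix, whence the Parseval identity. *)
Definition hcoef (c g : option bool) : C :=
  match c, g with
  | None, None => 1
  | Some false, Some _ => (2^-1)%:C
  | Some true, Some b => 0 +i* (if b then 2^-1 else - 2^-1)
  | _, _ => 0
  end.

Definition wphase (g : word N) (phi : 'I_N -> R) : C := \prod_n phase (g n) (phi n).

(** The pairing g.o: the derivative of [wphase g] in the direction [o] is i g.o times [wphase g]. *)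
Definition wfreq (o : 'cV[R]_N) (g : word N) : R := \sum_n (freq (g n))%:~R * o n 0.

Lemma trigfE (w : word N) n t :
  (if n \in wsupp w then hcoef (w n) (Some false) * phase (Some false) t
      + hcoef (w n) (Some true) * phase (Some true) t
   else hcoef (w n) None * phase None t) = (trigf (w n) t)%:C.
Proof.
rewrite inE; case: (w n) => [[]|] /=; rewrite ?mulr1 //;
  by apply/eqP; rewrite eq_complex /=; apply/andP; split; apply/eqP; field.
Qed.

(** Minus the termwise derivative of [trigfE]. *)
Lemma ndtrigfE (w : word N) n t :
  (if n \in wsupp w then hcoef (w n) (Some false) * (- 'i * phase (Some false) t)
      + hcoef (w n) (Some true) * ('i * phase (Some true) t)
   else 0) = (ndtrigf (w n) t)%:C.
Proof.
rewrite inE; case: (w n) => [[]|] /=; rewrite ?mulr1 //;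
  by apply/eqP; rewrite eq_complex /=; apply/andP; split; apply/eqP; field.
Qed.

Definition wcoef (w g : word N) : C := \prod_n hcoef (w n) (g n).

Lemma wfunE (w : word N) phi :
  (wfun w phi)%:C = \sum_(g | wsupp g == wsupp w) wcoef w g * wphase g phi.
Proof.
rewrite /wfun rmorph_prod /wcoef /wphase; under [RHS]eq_bigr do rewrite -big_split /=.
rewrite (sum_word_prod _ (fun n c => hcoef (w n) c * phase c (phi n))).
by apply: eq_bigr => n _; exact/esym/trigfE.
Qed.

Lemma wgradE o (w : word N) phi :
  (wgrad o w phi)%:C = \sum_(g | wsupp g == wsupp w) wcoef w g * ((- 'i * (wfreq o g)%:C) * wphase g phi).
Proof.
transitivity (\sum_k \sum_(g | wsupp g == wsupp w) wcoef w g * (- 'i * ((freq (g k))%:~R * o k 0)%:C * wphase g phi)); last first.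
  rewrite exchange_big /=; apply: eq_bigr => g _; rewrite -mulr_sumr; congr (_ * _).
  by rewrite /wfreq rmorph_sum mulr_sumr mulr_suml.
rewrite /wgrad rmorph_sum; apply: eq_bigr => k _.
(* The factor - i g_k is put under the product, at qubit [k], so that the sum over the frequencies
   factors over the qubits. *)
transitivity ((o k 0)%:C * \sum_(g | wsupp g == wsupp w)
   \prod_n (hcoef (w n) (g n) * ((if n == k then - 'i * (freq (g n))%:~R else 1) * phase (g n) (phi n)))).
  rewrite (sum_word_prod _ (fun n c => hcoef (w n) c * ((if n == k then - 'i * (freq c)%:~R else 1) * phase c (phi n)))).
  rewrite rmorphM; congr (_ * _).
  rewrite [RHS](bigD1 k) //= eqxx rmorphM rmorph_prod; congr (_ * _).
    rewrite -[_ (ndtrigf _ _)]/((ndtrigf (w k) (phi k))%:C) -ndtrigfE /= mulr1 mulrN1 opprK.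
    by rewrite mulr0 !mul0r mulr0.
  apply: eq_bigr => n /negbTE ->; rewrite -[_ (trigf _ _)]/((trigf (w n) (phi n))%:C) -trigfE.
  by rewrite !mul1r.
rewrite mulr_sumr; apply: eq_bigr => g _.
rewrite big_split big_split /= -/(wcoef w g) -/(wphase g phi).
rewrite (bigD1 k) //= eqxx big1 => [|n /negbTE ->//].
rewrite rmorphM rmorph_int; ring.
Qed.

End Parseval.

(** * Parseval's identity and comparison of the two quadratic forms *)

Section ParsevalForms.
Variables (R : realType) (N : nat).
Local Open Scope complex_scope.
Local Notation C := (R[i]).

(** On a qubit of the support, the two columns of coefficients, one for each frequency, are
    orthogonal of squared norm 1/2. *)
Lemma hcoef_orth (s : {set 'I_N}) n (c d : option bool) :
  has_supp s n c -> has_supp s n d ->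
  (if n \in s then hcoef R (Some false) c * (hcoef R (Some false) d)^*
      + hcoef R (Some true) c * (hcoef R (Some true) d)^*
   else hcoef R None c * (hcoef R None d)^*)
  = (c == d)%:R * (if n \in s then (2^-1)%:C else 1).
Proof.
rewrite /has_supp; case: (n \in s); case: c => [[]|]; case: d => [[]|] //= _ _;
  apply/eqP; rewrite eq_complex /=; apply/andP; split; apply/eqP; simpc; by [|field|rewrite /=; field].
Qed.

Lemma wcoef_orth (s : {set 'I_N}) (f g : word N) : wsupp f = s -> wsupp g = s ->
  \sum_(h | wsupp h == s) wcoef R h f * (wcoef R h g)^* = (f == g)%:R * (2^-1)%:C ^+ #|s|.
Proof.
move=> fs gs.
have hf n : has_supp s n (f n) by have /familyP/(_ n) : f \in family (has_supp s) by rewrite has_suppP fs.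
have hg n : has_supp s n (g n) by have /familyP/(_ n) : g \in family (has_supp s) by rewrite has_suppP gs.
transitivity (\sum_(h | wsupp h == s) \prod_n (hcoef R (h n) (f n) * (hcoef R (h n) (g n))^*)).
  by apply: eq_bigr => h _; rewrite /wcoef rmorph_prod -big_split.
rewrite (sum_word_prod s (fun n c => hcoef R c (f n) * (hcoef R c (g n))^*)).
under eq_bigr => n _ do rewrite (hcoef_orth (hf n) (hg n)).
rewrite big_split /=; congr (_ * _).
  case: (eqVneq f g) => [->|fg]; first by rewrite big1// => n _; rewrite eqxx.
  have /existsP[n nij] : [exists n, f n != g n].
    by apply: contraNT fg => /existsPn h; apply/eqP/ffunP => n; exact/eqP/negPn/h.
  by rewrite (bigD1 n) //= (negbTE nij) mul0r.
by rewrite -big_mkcond /= prodr_const.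
Qed.

Definition sqmod (z : C) : R := complex.Re z ^+ 2 + complex.Im z ^+ 2.

Lemma sqmodE (z : C) : (sqmod z)%:C = z * z^*.
Proof.
case: z => a b; apply/eqP; rewrite eq_complex /sqmod; simpc => /=.
by rewrite [b * a]mulrC addNr.
Qed.

Lemma sqmod_ge0 z : 0 <= sqmod z.
Proof. by rewrite addr_ge0// sqr_ge0. Qed.

(** By [wcoef_orth], passing from frequencies to words of the same support is unitary up to scaling,
    so the cross terms of the expanded squares cancel. *)
Lemma parseval (s : {set 'I_N}) (c : word N -> C) (a : word N -> R) :
  (forall h, wsupp h = s -> (a h)%:C = \sum_(g | wsupp g == s) wcoef R h g * c g) ->
  \sum_(h | wsupp h == s) a h ^+ 2 = 2^-1 ^+ #|s| * \sum_(g | wsupp g == s) sqmod (c g).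
Proof.
move=> ha; have : injective (fun x : R => x%:C) by move=> x y [].
apply; rewrite rmorphM !rmorph_sum /= rmorphXn.
transitivity (\sum_(h | wsupp h == s) \sum_(f | wsupp f == s) \sum_(g | wsupp g == s)
   (wcoef R h f * (wcoef R h g)^*) * (c f * (c g)^*)).
  apply: eq_bigr => h /eqP hs.
  have -> : (a h ^+ 2)%:C = (a h)%:C * ((a h)%:C)^*.
    by rewrite -sqmodE /sqmod /= expr0n addr0.
  rewrite ha// rmorph_sum mulr_suml; apply: eq_bigr => f _.
  by rewrite mulr_sumr; apply: eq_bigr => g _; rewrite rmorphM mulrACA.
rewrite exchange_big mulr_sumr /=; apply: eq_bigr => f /eqP fs.
rewrite exchange_big (bigD1 f) /=; last exact/eqP.
rewrite [X in _ + X]big1 ?addr0; last first.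
  by move=> g /andP[/eqP gs gf]; rewrite -mulr_suml wcoef_orth// eq_sym (negbTE gf) !mul0r.
by rewrite -mulr_suml wcoef_orth// eqxx mul1r sqmodE.
Qed.

Variables (I : finType) (o : 'cV[R]_N) (phi : I -> 'I_N -> R) (v : I -> R).

(** Both forms are sums of |c g|^2 over the frequencies, with the same factor 2^-S, the second one
    weighted by (g.o)^2. Such a g has entries in {-1, 0, 1} and l1 norm S, which places the weight
    between [Delta] and the squared norm. *)
Lemma form_bounds (S : nat) (s : {set 'I_N}) : #|s| = S -> (0 < S)%N ->
  Delta S o * (\sum_(h | wsupp h == s) (\sum_a v a * wfun h (phi a)) ^+ 2)
    <= \sum_(h | wsupp h == s) (\sum_a v a * wgrad o h (phi a)) ^+ 2
    <= absum o ^+ 2 * (\sum_(h | wsupp h == s) (\sum_a v a * wfun h (phi a)) ^+ 2).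
Proof.
move=> sS S0.
pose c g := \sum_a (v a)%:C * wphase g (phi a).
rewrite (@parseval s c (fun h => \sum_a v a * wfun h (phi a))); last first.
  move=> h hs; rewrite rmorph_sum /=.
  under [RHS]eq_bigr do rewrite mulr_sumr.
  rewrite exchange_big; apply: eq_bigr => a _; rewrite rmorphM /= wfunE hs mulr_sumr.
  by apply: eq_bigr => g _; rewrite mulrCA.
rewrite (@parseval s (fun g => - 'i * (wfreq o g)%:C * c g) (fun h => \sum_a v a * wgrad o h (phi a))); last first.
  move=> h hs; rewrite rmorph_sum /=.
  under [RHS]eq_bigr do rewrite !mulr_sumr.
  rewrite exchange_big; apply: eq_bigr => a _; rewrite rmorphM /= wgradE hs mulr_sumr.
  by apply: eq_bigr => g _; ring.
have sq g : sqmod (- 'i * (wfreq o g)%:C * c g) = wfreq o g ^+ 2 * sqmod (c g).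
  by case: (c g) => x y; rewrite /sqmod; simpc => /=; ring.
rewrite [\sum_(g | _) sqmod (_ * c g)](eq_bigr _ (fun g _ => sq g)).
rewrite !(mulrCA _ (_ ^+ #|s|)) !ler_pM2l ?exprn_gt0 ?invr_gt0// !mulr_sumr.
apply/andP; split; apply: ler_sum => g /eqP gs; apply: ler_wpM2r (sqmod_ge0 _) _ _ _.
  apply: Delta_le.
    by move=> n; rewrite /freq; case: (g n) => [[]|].
  have -> : \sum_n `|freq (g n)| = S%:Z.
    rewrite -sS -gs -sum1_card (big_morph Posz PoszD (erefl (Posz 0))) [RHS]big_mkcond.
    by apply: eq_bigr => n _; rewrite inE /freq; case: (g n) => [[]|].
  by rewrite lexx andbT.
rewrite -[X in X <= _]real_normK ?num_real// lerXn2r ?nnegrE ?sumr_ge0//.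
apply: le_trans (ler_norm_sum _ _ _) _; apply: ler_sum => k _.
rewrite normrM -[X in _ <= X]mul1r ler_wpM2r//.
by rewrite /freq; case: (g k) => [[]|] /=; rewrite ?normr0 ?normrN ?normr1.
Qed.

End ParsevalForms.

(** * Probabilities of finite configurations of independent sources *)

Section FiniteIndependence.
Context {R : realType} {disp : measure_display} {T : measurableType disp}.
Variable P : probability T R.

(* io selects, among the independent sources, those the events Ev depend on. *)
Lemma probability_configurations (J : finType) (F : J -> set (set T)) (I V : finType)
    (io : I -> J) (Ev : I -> V -> set T) (A : {set V}) (good : {set {ffun I -> V}}) :
  mutually_independent P F -> injective io ->
  (forall i v, measurable (Ev i v)) ->
  (forall i v, F (io i) (Ev i v)) ->
  (forall j, exists B, F j B) ->
  (forall i u v, u != v -> Ev i u `&` Ev i v = set0) ->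
  (forall i v, v \in A -> P (Ev i v) = (#|A|%:R^-1)%:E) ->
  {subset good <= ffun_on (mem A)} ->
  P (\bigcup_(f in [set` good]) \bigcap_(i in setT) Ev i (f i))
    = (#|good|%:R / #|A|%:R ^+ #|I|)%:E.
Proof.
move=> ind ioi mE FE F0 dj PA gA.
pose cell (f : {ffun I -> V}) := \bigcap_(i in [set: I]) Ev i (f i).
have mcell f : measurable (cell f) by apply: fin_bigcap_measurable.
have djc f g : f != g -> cell f `&` cell g = set0.
  move=> fg; have /existsP[i nij] : [exists i, f i != g i].
    by apply: contraNT fg => /existsPn h; apply/eqP/ffunP => i; exact/eqP/negPn/h.
  by rewrite -subset0 => t [/(_ i Logic.I) a /(_ i Logic.I) b]; rewrite -(dj i _ _ nij).
have Pcell f : f \in good -> P (cell f) = ((#|A|%:R ^+ #|I|)^-1)%:E.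
  move=> /gA/ffun_onP fA.
  (* Independence asks for an event of every source: those outside the image of [io] receive an
     arbitrary one, which does not enter the intersection over the image. *)
  have [B FB] := choice F0.
  pose E j := if [pick i | io i == j] is Some i then Ev i (f i) else B j.
  have EE i : E (io i) = Ev i (f i).
    rewrite /E; case: pickP => [i' /eqP/ioi ->//|/(_ i)]; by rewrite eqxx.
  have FEj j : F j (E j) by rewrite /E; case: pickP => [i /eqP <-|_].
  have := ind (io @: setTfor I) E FEj.
  rewrite big_imset /=; last by move=> ? ? _ _; exact: ioi.
  rewrite (eq_bigr (fun=> (#|A|%:R^-1)%:E)) => [|i _]; last by rewrite EE PA// fA.
  rewrite prodEFin prodr_const cardsT exprVn => <-; congr (P _).
  apply/seteqP; split => t.
    by move=> ct _ /imsetP[i _ ->]; rewrite EE; exact: ct.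
  by move=> ct i _; rewrite -EE; apply: ct; exact: imset_f.
rewrite (measure_fin_bigcup P); first last.
- by move=> f _; exact: mcell.
- by apply/trivIsetP => f g _ _ fg; exact: djc.
- exact: finite_finset.
rewrite -(@bigfs _ _ _ _ (index_enum _)) ?index_enum_uniq// => [|f _]; last by rewrite mem_index_enum.
rewrite (eq_bigr (fun=> ((#|A|%:R ^+ #|I|)^-1)%:E)) => [|f fg]; last exact: Pcell.
by rewrite sumEFin sumr_const mulr_natl.
Qed.

Lemma measurable_configurations (I V : finType) (Ev : I -> V -> set T)
    (good : {set {ffun I -> V}}) :
  (forall i v, measurable (Ev i v)) ->
  measurable (\bigcup_(f in [set` good]) \bigcap_(i in setT) Ev i (f i)).
Proof.
move=> mE; apply: fin_bigcup_measurable => // f _.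
exact: fin_bigcap_measurable.
Qed.

End FiniteIndependence.

(** * Chernoff bound by counting words *)

Lemma expR_quad (R : realType) (t : R) : `|t| <= 4^-1 -> expR t <= 1 + t + t ^+ 2.
Proof.
rewrite ler_norml => /andP[t1 t2].
have h : 0 < 1 - t / 2 by lra.
have e1 : expR (t / 2) <= (1 - t / 2)^-1.
  rewrite -[expR _]invrK lef_pV2 ?posrE ?invr_gt0 ?expR_gt0//.
  by rewrite -expRN; have := expR_ge1Dx (- (t / 2)); lra.
have -> : t = t / 2 + t / 2 by lra.
rewrite expRD; apply: (@le_trans _ _ ((1 - t / 2)^-1 ^+ 2)).
  by rewrite expr2 ler_pM ?expR_ge0.
(* (1 + t + t^2) (1 - t/2)^2 - 1 = t^2 (1 - 3 t + t^2) / 4, nonnegative for t at most 1/4. *)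
rewrite exprVn -[X in X <= _]mul1r ler_pdivrMr ?exprn_gt0//; nra.
Qed.

Section Chernoff.
Variables (R : realType) (V : finType) (A : {set V}) (D : nat).

Definition occ (f : {ffun 'I_D -> V}) (v : V) : nat := \sum_d (f d == v).

(** Divided by |A|^D, this is the moment generating function of a binomial count; the sum factors
    over the D positions. *)
Lemma mgf_occ (v : V) (l : R) : v \in A ->
  \sum_(f in ffun_on (mem A)) expR (l * (occ f v)%:R)
   = (#|A|%:R + (expR l - 1)) ^+ D.
Proof.
move=> vA.
transitivity (\sum_(f in @ffun_on_mem 'I_D V (mem A)) \prod_d (if f d == v then expR l else 1)).
  apply: eq_bigr => f _; rewrite /occ natr_sum mulr_sumr expR_sum; apply: eq_bigr => d _.
  by case: eqP; rewrite ?mulr1 ?mulr0 ?expR0.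
rewrite -(bigA_distr_big (mem A) (fun (_ : 'I_D) u => if u == v then expR l else 1)).
rewrite prodr_const card_ord; congr (_ ^+ _).
rewrite (bigD1 v) //= eqxx (cardD1 v) vA -sum1_card natrD natr_sum.
rewrite (eq_bigr (fun=> 1)) => [|u /andP[_ /negbTE ->]//].
rewrite [in RHS](eq_bigl (fun u => (u \in A) && (u != v))); last by move=> u; rewrite !inE andbC.
by rewrite mulr1n; ring.
Qed.

Local Notation x := (#|A|%:R : R).

(** Markov's inequality for exp (t n_v). The sign of t selects the upper or the lower tail, the
    relative deviation being 2 |t|; one t^2 of the threshold absorbs the quadratic term of
    [expR_quad], the other is the gain. *)
Lemma card_tail (v : V) (t : R) : v \in A -> `|t| <= 4^-1 ->
  #|[set f in ffun_on (mem A) | 2 * t ^+ 2 * (D%:R / x) <= t * ((occ f v)%:R - D%:R / x)]|%:R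
    <= x ^+ D * expR (- (t ^+ 2 * (D%:R / x))).
Proof.
move=> vA t4.
have x0 : 0 < x by rewrite ltr0n; apply/card_gt0P; exists v.
rewrite -sum1_card natr_sum big_mkcond /=.
apply: (@le_trans _ _ (\sum_(f in ffun_on (mem A))
   expR (t * (occ f v)%:R) * expR (- (t * (D%:R / x) + 2 * t ^+ 2 * (D%:R / x))))).
  rewrite [leRHS]big_mkcond /=; apply: ler_sum => f _; rewrite inE.
  case: (f \in _) => //=; case: ifP => h; last by rewrite mulr_ge0 ?expR_ge0.
  by rewrite -expRD -[X in X <= _]expR0 ler_expR; lra.
rewrite -mulr_suml mgf_occ//.
have -> : x + (expR t - 1) = x * (1 + (expR t - 1) / x) by field; rewrite gt_eqF.
rewrite exprMn -[X in X <= _]mulrA ler_pM2l ?exprn_gt0//.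
have e1 : 1 + (expR t - 1) / x <= expR ((t + t ^+ 2) / x).
  apply: le_trans (expR_ge1Dx _) ; rewrite lerD2l ler_pM2r ?invr_gt0//.
  by have := expR_quad t4; lra.
have e0 : 0 <= 1 + (expR t - 1) / x.
  rewrite -(pmulr_rge0 _ x0) mulrDr mulrCA divff ?gt_eqF// !mulr1.
  have : 1 <= x by rewrite -[1]/(1%:R) ler_nat; apply/card_gt0P; exists v.
  by have := expR_gt0 t; lra.
apply: (@le_trans _ _ (expR ((t + t ^+ 2) / x) ^+ D * expR (- (t * (D%:R / x) + 2 * t ^+ 2 * (D%:R / x))))).
  by rewrite ler_pM2r ?expR_gt0// lerXn2r ?nnegrE ?expR_ge0.
rewrite -expRM_natl -expRD ler_expR le_eqVlt; apply/orP; left; apply/eqP; ring.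
Qed.

Definition balanced (eta : R) : {set {ffun 'I_D -> V}} :=
  [set f in ffun_on (mem A) | [forall v in A, `|(occ f v)%:R - D%:R / x| <= eta * (D%:R / x)]].

(** Union bound over the letters and the two tails t = eta/2 and t = - eta/2; eta at most 1/2 gives
    the |t| <= 1/4 of [card_tail]. *)
Lemma card_balanced (eta : R) : 0 < eta <= 2^-1 ->
  x ^+ D * (1 - 2 * x * expR (- (eta ^+ 2 / 4 * (D%:R / x)))) <= #|balanced eta|%:R.
Proof.
move=> /andP[eta0 eta2].
pose tail (t : R) v := [set f : {ffun 'I_D -> V} in ffun_on (mem A)
   | 2 * t ^+ 2 * (D%:R / x) <= t * ((occ f v)%:R - D%:R / x)].
pose all_ := [set f : {ffun 'I_D -> V} in ffun_on (mem A)].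
have ct v t : v \in A -> `|t| = eta / 2 -> #|tail t v|%:R <= x ^+ D * expR (- (eta ^+ 2 / 4 * (D%:R / x))).
  move=> vA ht; have -> : eta ^+ 2 / 4 = t ^+ 2.
    by rewrite -[RHS]real_normK ?num_real// ht; field.
  by apply: card_tail => //; rewrite ht; lra.
have sub : all_ \subset balanced eta :|: \bigcup_(v in A) (tail (eta / 2) v :|: tail (- (eta / 2)) v).
  apply/fintype.subsetP => f; rewrite !inE => fA; rewrite fA /=.
  apply/orP; have [h|/forall_inPn[v vA]] := boolP [forall v in A, `|(occ f v)%:R - D%:R / x| <= eta * (D%:R / x)].
    by left.
  rewrite -ltNge ltr_normr => h; right; apply/bigcupP; exists v => //; rewrite !inE fA /=.
  have e2 : 0 < eta / 2 by lra.
  case/orP: h => /ltW h; apply/orP; [left|right].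
    by have := ler_wpM2l (ltW e2) h; rewrite expr2; lra.
  by have := ler_wpM2l (ltW e2) h; rewrite expr2; lra.
have call : #|all_| = (#|A| ^ D)%N.
  by rewrite -[D in RHS]card_ord -card_ffun_on; apply: eq_card => f; rewrite inE.
have cardU (B C : {set {ffun 'I_D -> V}}) : (#|B :|: C| <= #|B| + #|C|)%N.
  by rewrite cardsU leq_subr.
pose U := (\bigcup_(v in A) (tail (eta / 2)%R v :|: tail (- (eta / 2))%R v))%SET.
have big : (#|U|
     <= \sum_(v in A) (#|tail (eta / 2)%R v| + #|tail (- (eta / 2))%R v|))%N.
  rewrite /U; apply: (big_rec2 (fun (B : {set {ffun 'I_D -> V}}) n => (#|B| <= n)%N)).
    by rewrite cards0.
  move=> v B n _ IH; apply: leq_trans (cardU _ _) _.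
  by apply: leq_add IH; exact: cardU.
have := leq_trans (subset_leq_card sub) (leq_trans (cardU _ _) (leq_add (leqnn _) big)).
rewrite call -(ler_nat R) natrX natrD natr_sum => h.
rewrite mulrBr mulr1 lerBlDr; apply: le_trans h _; rewrite lerD2l.
apply: (@le_trans _ _ (\sum_(v in A) (x ^+ D * expR (- (eta ^+ 2 / 4 * (D%:R / x))) *+ 2))).
  apply: ler_sum => v vA; rewrite natrD [X in _ <= X]mulr2n; apply: lerD; apply: ct => //.
    by rewrite gtr0_norm//; lra.
  by rewrite normrN gtr0_norm//; lra.
by rewrite sumr_const -mulrnA -[X in X <= _]mulr_natr natrM; lra.
Qed.

End Chernoff.

(** * Orthogonality of cosine and sine on a grid *)

Section Grid.
Variables (R : realType) (L : nat).
Hypothesis L0 : (0 < L)%N.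
Local Notation M := (4 * L)%N.

(* Independence is only available for events: the data are discretized on a grid,
   where the functions cos and sin are exactly orthogonal (4 divides its size). *)
Definition gridpt (j : nat) : R := -1 + 2 * (j%:R / M%:R).

Lemma gridptD j : gridpt (j + L) = gridpt j + 2^-1.
Proof. by rewrite /gridpt natrD natrM; field; rewrite pnatr_eq0 -lt0n. Qed.

(** A shift by 1/2, a quarter of the period, moves the grid by L points, and periodicity brings the
    last L points back to the first L. *)
Lemma sum_grid_shift (f : R -> R) : (forall t, f (t + 2) = f t) ->
  \sum_(j < M) f (gridpt j + 2^-1) = \sum_(j < M) f (gridpt j).
Proof.
move=> f2.
have fM j : f (gridpt (j + M)) = f (gridpt j).
  by rewrite -[RHS]f2; congr f; rewrite /gridpt natrD natrM; field; rewrite pnatr_eq0 -lt0n.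
rewrite -!(big_mkord xpredT (fun j => f (gridpt j + 2^-1))) -(big_mkord xpredT (fun j => f (gridpt j))).
under eq_bigr do rewrite -gridptD.
transitivity (\sum_(0 + L <= j < M + L) f (gridpt j)); first by rewrite big_addn addnK.
rewrite add0n.
have LM : (L <= M)%N by rewrite leq_pmull.
rewrite (@big_cat_nat _ _ _ M) ?LM ?leq_addr//=.
rewrite [X in _ + X](_ : _ = \sum_(0 <= j < L) f (gridpt j)); last first.
  by rewrite -{1}[M]add0n big_addn addKn; apply: eq_bigr => j _; rewrite fM.
by rewrite addrC -big_cat_nat.
Qed.

Lemma trigf_periodic c (t : R) : trigf c (pi * (t + 2)) = trigf c (pi * t).
Proof.
have -> : pi * (t + 2) = pi * t + pi + pi by ring.
by case: c => [[]|] //=; rewrite ?sinDpi ?cosDpi ?opprK.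
Qed.

Lemma trigf_quarter c (t : R) : trigf c (pi * (t + 2^-1)) =
  match c with None => 1 | Some false => - sin (pi * t) | Some true => cos (pi * t) end.
Proof.
have -> : pi * (t + 2^-1) = pi * t + pi / 2 by ring.
by case: c => [[]|] //=; rewrite ?sinDpihalf ?cosDpihalf.
Qed.

(** The quarter shift sends cos to - sin and sin to cos. Invariance of the sums under it makes the
    sums of cos, of sin and of their product vanish and those of cos^2 and sin^2 agree; the last two
    add up to the number of points. *)
Lemma grid_orthogonal c d :
  \sum_(j < M) trigf c (pi * gridpt j) * trigf d (pi * gridpt j)
  = if c == d then (if c == None then M%:R else M%:R / 2) else 0.
Proof.
have sh c' d' : \sum_(j < M) trigf c' (pi * (gridpt j + 2^-1)) * trigf d' (pi * (gridpt j + 2^-1))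
   = \sum_(j < M) trigf c' (pi * gridpt j) * trigf d' (pi * gridpt j).
  by apply: (@sum_grid_shift (fun t => trigf c' (pi * t) * trigf d' (pi * t))) => t; rewrite !trigf_periodic.
pose Sc := \sum_(j < M) cos (pi * gridpt j); pose Ss := \sum_(j < M) sin (pi * gridpt j).
pose Scc := \sum_(j < M) cos (pi * gridpt j) * cos (pi * gridpt j).
pose Sss := \sum_(j < M) sin (pi * gridpt j) * sin (pi * gridpt j).
pose Scs := \sum_(j < M) cos (pi * gridpt j) * sin (pi * gridpt j).
have X0 : - Ss = Sc.
  have := sh (Some false) None; rewrite (eq_bigr (fun j : 'I_M => - sin (pi * gridpt j))) => [|j _].
    by rewrite sumrN => ->; apply: eq_bigr => j _; rewrite mulr1.
  by rewrite !trigf_quarter mulr1.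
have Y0 : Sc = Ss.
  have := sh (Some true) None; rewrite (eq_bigr (fun j : 'I_M => cos (pi * gridpt j))) => [|j _].
    by move=> h; rewrite /Sc h; apply: eq_bigr => j _; rewrite mulr1.
  by rewrite !trigf_quarter mulr1.
have XX : Sss = Scc.
  have := sh (Some false) (Some false); rewrite (eq_bigr (fun j : 'I_M => sin (pi * gridpt j) * sin (pi * gridpt j))) => [|j _] //.
  by rewrite !trigf_quarter mulrNN.
have XY : - Scs = Scs.
  have := sh (Some false) (Some true); rewrite (eq_bigr (fun j : 'I_M => - (cos (pi * gridpt j) * sin (pi * gridpt j)))) => [|j _].
    by rewrite sumrN.
  by rewrite !trigf_quarter mulNr mulrC.
have sq : Scc + Sss = M%:R.
  rewrite -big_split /= (eq_bigr (fun=> 1)) => [|j _]; last by rewrite -!expr2 cos2Dsin2.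
  by rewrite sumr_const card_ord.

case: c d => [[]|] [[]|] /=.
- by rewrite -/Sss; lra.
- by under eq_bigr do rewrite mulrC; rewrite -/Scs; lra.
- by under eq_bigr do rewrite mulr1; rewrite -/Ss; lra.
- by rewrite -/Scs; lra.
- by rewrite -/Scc; lra.
- by under eq_bigr do rewrite mulr1; rewrite -/Sc; lra.
- by under eq_bigr do rewrite mul1r; rewrite -/Ss; lra.
- by under eq_bigr do rewrite mul1r; rewrite -/Sc; lra.
- by rewrite mulr1 sumr_const card_ord.
Qed.

End Grid.

(** * Gram matrix and its second moments over grid data *)

Section Gram.
Variables (R : realType) (N m S : nat) (Q : {set {set 'I_N}}).
Hypothesis Q0 : Q != finset.set0.
Hypothesis QS : forall s, s \in Q -> #|s| = S.

Definition gate_words : {set word N} := finset.finset (fun w => wsupp w \in Q).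

Lemma sum_gate_words (V : nmodType) (F : word N -> V) :
  \sum_(w in gate_words) F w = \sum_(s in Q) \sum_(w | wsupp w == s) F w.
Proof.
rewrite (partition_big (@wsupp N) (mem Q)) /=; last by move=> w; rewrite inE.
apply: eq_bigr => s sQ; apply: eq_bigl => w; rewrite inE.
by case: eqVneq => [->|]; rewrite ?sQ// andbF.
Qed.

Lemma card_supp_words (s : {set 'I_N}) : (\sum_(w : word N | wsupp w == s) 1 = 2 ^ #|s|)%N.
Proof.
apply/eqP; rewrite -(eqr_nat R) natr_sum.
rewrite (eq_bigr (fun w : word N => \prod_(n < N) (1 : R))) => [|w _]; last by rewrite big1.
by rewrite (sum_word_prod s (fun _ _ => 1 : R)) -big_mkcond /= prodr_const natrX.
Qed.

Lemma card_gate_words : #|gate_words| = (#|Q| * 2 ^ S)%N.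
Proof.
rewrite -sum1_card sum_gate_words (eq_bigr (fun=> 2 ^ S)%N) => [|s sQ].
  by rewrite sum_nat_const.
by rewrite card_supp_words (QS sQ).
Qed.

Implicit Types (phi : 'I_m -> 'I_N -> R) (v : 'I_m -> R).

Definition gram phi (a b : 'I_m) : R :=
  #|Q|%:R^-1 * \sum_(w in gate_words) wfun w (phi a) * wfun w (phi b).

(** For each support the sum of squares is a product over its qubits of cos^2 + sin^2 = 1. *)
Lemma gram_diag phi a : gram phi a a = 1.
Proof.
rewrite /gram sum_gate_words (eq_bigr (fun=> 1)) => [|s sQ].
  rewrite sumr_const mulVf// pnatr_eq0 cards_eq0; exact: Q0.
rewrite (eq_bigr (fun w : word N => \prod_n (trigf (w n) (phi a n) * trigf (w n) (phi a n)))) => [|w _]; last by rewrite big_split.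
rewrite (sum_word_prod s (fun n c => trigf c (phi a n) * trigf c (phi a n))) big1 // => n _.
by case: ifP => _ /=; rewrite ?mulr1// -!expr2 cos2Dsin2.
Qed.

Lemma gram_form phi v :
  \sum_a \sum_b v a * v b * gram phi a b
  = #|Q|%:R^-1 * \sum_(w in gate_words) (\sum_a v a * wfun w (phi a)) ^+ 2.
Proof.
rewrite mulr_sumr.
transitivity (\sum_a \sum_b \sum_(w in gate_words) #|Q|%:R^-1 * ((v a * wfun w (phi a)) * (v b * wfun w (phi b)))).
  apply: eq_bigr => a _; apply: eq_bigr => b _.
  by rewrite /gram !mulr_sumr; apply: eq_bigr => w _; ring.
under eq_bigr do rewrite exchange_big /=.
rewrite exchange_big /=; apply: eq_bigr => w _.
rewrite expr2 mulr_suml mulr_sumr; apply: eq_bigr => a _.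
by rewrite !mulr_sumr.
Qed.

Section GridMoments.
Variable L : nat.
Hypothesis L0 : (0 < L)%N.
Local Notation M := (4 * L)%N.
Local Notation config := {ffun 'I_m * 'I_N -> 'I_M}.

Definition gridphi (c : config) (a : 'I_m) (n : 'I_N) : R := pi * gridpt R L (c (a, n)).

Lemma sum_grid_word (h k : word N) : wsupp h \in Q ->
  \prod_(n < N) \sum_(j < M) trigf (h n) (pi * gridpt R L j) * trigf (k n) (pi * gridpt R L j)
  = M%:R ^+ N * ((h == k)%:R * 2^-1 ^+ S).
Proof.
move=> hQ; under eq_bigr do rewrite grid_orthogonal//.
have -> : M%:R ^+ N = \prod_(n < N) M%:R :> R by rewrite prodr_const card_ord.
case: (eqVneq h k) => [<-|hk].
  rewrite mul1r -(QS hQ) -prodr_const [X in _ = _ * X]big_mkcond -big_split; apply: eq_bigr => n _ /=.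
  by rewrite eqxx inE; case: eqP; rewrite /= ?mulr1.
have /existsP[n nij] : [exists n, h n != k n].
  by apply: contraNT hk => /existsPn e; apply/eqP/ffunP => n; exact/eqP/negPn/e.
by rewrite (bigD1 n) //= (negbTE nij) !mul0r mulr0.
Qed.

Let prod_pair (F : 'I_m * 'I_N -> R) : \prod_p F p = \prod_(a < m) \prod_(n < N) F (a, n).
Proof. by rewrite pair_bigA; apply: eq_bigr => -[]. Qed.

(** The entries of the rows [a] and [b] are summed separately: by orthogonality each of the two rows
    gives 2^-S if h = k and 0 otherwise, relative to the number of grid points. *)
Lemma sum_config_pair (h k : word N) (a b : 'I_m) : wsupp h \in Q -> a != b ->
  \sum_(c : config) wfun h (gridphi c a) * wfun h (gridphi c b)
     * (wfun k (gridphi c a) * wfun k (gridphi c b))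
  = M%:R ^+ (m * N) * ((h == k)%:R * 4^-1 ^+ S).
Proof.
move=> hQ ab.
pose G (n : 'I_N) (j : 'I_M) : R := trigf (h n) (pi * gridpt R L j) * trigf (k n) (pi * gridpt R L j).
(* The value 1 on the other rows makes the summand a product over all entries, so that the sum over
   configurations distributes. *)
pose F (p : 'I_m * 'I_N) (j : 'I_M) : R := if (p.1 == a) || (p.1 == b) then G p.2 j else 1.
transitivity (\sum_(c : config) \prod_p F p (c p)).
  apply: eq_bigr => c _; rewrite prod_pair.
  rewrite (bigD1 a) //= (bigD1 b) 1?eq_sym //= [X in _ = _ * (_ * X)]big1 ?mulr1; last first.
    by move=> a' /andP[/negbTE na /negbTE nb]; rewrite big1// => n _; rewrite /F /= na nb.
  rewrite /F /= !eqxx orbT /= /wfun /gridphi !big_split /=; ring.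
rewrite -bigA_distr_bigA prod_pair.
transitivity (\prod_(a' < m) (M%:R ^+ N * (if (a' == a) || (a' == b) then (h == k)%:R * 2^-1 ^+ S else 1)) : R).
  apply: eq_bigr => a' _; rewrite /F /=; case: ifP => _; first exact: sum_grid_word.
  by rewrite mulr1 (eq_bigr (fun=> M%:R)) ?prodr_const ?card_ord// => n _; rewrite sumr_const card_ord.
rewrite big_split /= prodr_const card_ord -exprM [(N * m)%N]mulnC; congr (_ * _).
rewrite (bigD1 a) //= (bigD1 b) 1?eq_sym //= [X in _ * (_ * X) = _]big1 ?mulr1; last first.
  by move=> a' /andP[/negbTE na /negbTE nb]; rewrite na nb.
rewrite !eqxx orbT mulrACA -exprMn; congr (_ * _).
  by case: (h == k); rewrite ?mulr1 ?mulr0.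
by congr (_ ^+ _); field.
Qed.

(** Of the pairs of words in the expanded square only the |Q| 2^S diagonal ones survive, each
    contributing 4^-S / |Q|^2. *)
Lemma sum_config_gram (a b : 'I_m) : a != b ->
  \sum_(c : config) gram (gridphi c) a b ^+ 2 = M%:R ^+ (m * N) * (2^-1 ^+ S / #|Q|%:R).
Proof.
move=> ab.
have q0 : #|Q|%:R != 0 :> R by rewrite pnatr_eq0 cards_eq0; exact: Q0.
transitivity (#|Q|%:R ^- 2 * \sum_(h in gate_words) \sum_(k in gate_words) \sum_(c : config)
   (wfun h (gridphi c a) * wfun h (gridphi c b) * (wfun k (gridphi c a) * wfun k (gridphi c b)))).
  rewrite mulr_sumr; under [RHS]eq_bigr do rewrite exchange_big /= mulr_sumr.
  rewrite [RHS]exchange_big; apply: eq_bigr => c _.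
  rewrite /gram exprMn exprVn [(\sum_(_ in _) _) ^+ 2]expr2 mulr_suml mulr_sumr; apply: eq_bigr => h _.
  by rewrite mulr_sumr.
rewrite (eq_bigr (fun=> M%:R ^+ (m * N) * 4^-1 ^+ S)) => [|h hQ].
  rewrite sumr_const card_gate_words -[_ *+ (_ * _)]mulr_natl [(#|Q| * _)%:R]natrM natrX.
  move: (M%:R ^+ _) => MM.
  have -> : 4^-1 = 2^-1 * 2^-1 :> R by field.
  rewrite exprMn; have e : (2 ^+ S) * (2^-1 ^+ S) = 1 :> R by rewrite -exprMn mulfV// expr1n.
  transitivity (#|Q|%:R ^- 2 * #|Q|%:R * MM * 2^-1 ^+ S * (2 ^+ S * 2^-1 ^+ S) : R); first ring.
  by rewrite e mulr1; field.
have hQ' : wsupp h \in Q by move: hQ; rewrite inE.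
rewrite (bigD1 h) //= [X in _ + X]big1 ?addr0; last first.
  by move=> k /andP[_ kh]; rewrite sum_config_pair// eq_sym (negbTE kh) mul0r mulr0.
by rewrite sum_config_pair// eqxx mul1r.
Qed.

End GridMoments.
End Gram.

(** * Lipschitz estimates *)

Section TrigLipschitz.
Variable R : realType.

Lemma is_derive_le1_lipschitz (f df : R -> R) : (forall t : R, is_derive t 1 f (df t)) ->
  (forall t, `|df t| <= 1) -> forall s t, `|f s - f t| <= `|s - t|.
Proof.
move=> fd df1 s t; wlog ts : s t / t <= s => [hw|].
  by case: (leP t s) => [/hw//|/ltW/hw]; rewrite distrC [X in _ <= X]distrC.
have cf : {within `[t, s], continuous f}.
  by apply: derivable_within_continuous => x _; have := fd x => -[].
have [c _ ->] := @MVT_segment R f df t s ts (fun x _ => fd x) cf.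
by rewrite normrM -[X in _ <= X]mul1r ler_wpM2r.
Qed.

Lemma trigf_lipschitz c (s t : R) : `|trigf c s - trigf c t| <= `|s - t|.
Proof.
case: c => [[]|] /=; last by rewrite subrr normr0.
  apply: (@is_derive_le1_lipschitz (@sin R) (@cos R)) => u; exact: cos_max.
apply: (@is_derive_le1_lipschitz (@cos R) (fun u => - sin u)) => u.
by rewrite normrN sin_max.
Qed.

Lemma trigf_le1 c (t : R) : `|trigf c t| <= 1.
Proof. by case: c => [[]|] /=; rewrite ?sin_max ?cos_max ?normr1. Qed.

(** One factor is replaced at a time, the others being bounded by 1. *)
Lemma prod_lipschitz (I : Type) (r : seq I) (f g : I -> R) :
  (forall i, `|f i| <= 1) -> (forall i, `|g i| <= 1) ->
  `|\prod_(i <- r) f i - \prod_(i <- r) g i| <= \sum_(i <- r) `|f i - g i|.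
Proof.
move=> f1 g1.
have pf1 s : `|\prod_(i <- s) f i| <= 1.
  by rewrite normr_prod; apply: prodr_ile1 => i _; rewrite normr_ge0 f1.
elim: r => [|i r IH]; first by rewrite !big_nil subrr normr0.
rewrite !big_cons.
have -> : f i * \prod_(j <- r) f j - g i * \prod_(j <- r) g j =
  (f i - g i) * \prod_(j <- r) f j + g i * (\prod_(j <- r) f j - \prod_(j <- r) g j) by ring.
apply: le_trans (ler_normD _ _) _; rewrite !normrM; apply: lerD.
  by rewrite -[X in _ <= X]mulr1 ler_wpM2l.
by apply: le_trans IH; rewrite -[X in _ <= X]mul1r ler_wpM2r.
Qed.

Variable N : nat.

Lemma wfun_le1 (w : word N) (phi : 'I_N -> R) : `|wfun w phi| <= 1.
Proof.
by rewrite normr_prod; apply: prodr_ile1 => i _; rewrite normr_ge0 trigf_le1.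
Qed.

Lemma wfun_lipschitz (w : word N) (phi psi : 'I_N -> R) (e : R) :
  (forall n, `|phi n - psi n| <= e) -> `|wfun w phi - wfun w psi| <= N%:R * e.
Proof.
move=> pe; apply: le_trans (prod_lipschitz _ _ _) _ => [i|i|]; rewrite ?trigf_le1//.
rewrite mulr_natl -[N in _ *+ N]card_ord -sumr_const; apply: ler_sum => n _.
exact: le_trans (trigf_lipschitz _ _ _) (pe n).
Qed.
End TrigLipschitz.

(** * Data with a nearly orthonormal Gram matrix *)

Lemma amgm (R : realFieldType) (alpha p g : R) : 0 < alpha ->
  `|p| * `|g| <= (alpha * p ^+ 2 + alpha^-1 * g ^+ 2) / 2.
Proof.
move=> a0; rewrite -(real_normK (num_real p)) -(real_normK (num_real g)).
move: `|p| `|g| => {}p {}g; rewrite -subr_ge0.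
have -> : (alpha * p ^+ 2 + alpha^-1 * g ^+ 2) / 2 - p * g = alpha^-1 / 2 * (alpha * p - g) ^+ 2.
  by field; rewrite gt_eqF.
by rewrite mulr_ge0 ?sqr_ge0// divr_ge0// invr_ge0 ltW.
Qed.

Section GoodData.
Variables (R : realType) (N m S : nat) (Q : {set {set 'I_N}}).
Hypothesis Q0 : Q != finset.set0.
Hypothesis QS : forall s, s \in Q -> #|s| = S.

Lemma gram_near (phi psi : 'I_m -> 'I_N -> R) (e : R) a b :
  (forall a n, `|phi a n - psi a n| <= e) ->
  `|gram Q phi a b - gram Q psi a b| <= 2 * 2 ^+ S * N%:R * e.
Proof.
move=> pe; have Qpos : 0 < #|Q|%:R :> R by rewrite ltr0n card_gt0.
rewrite /gram -mulrBr normrM ger0_norm ?invr_ge0 ?ler0n// mulrC ler_pdivrMr// -sumrB.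
apply: le_trans (ler_norm_sum _ _ _) _.
apply: (@le_trans _ _ (\sum_(w in gate_words Q) (2 * (N%:R * e)))).
  apply: ler_sum => w _.
  have -> : wfun w (phi a) * wfun w (phi b) - wfun w (psi a) * wfun w (psi b) =
    (wfun w (phi a) - wfun w (psi a)) * wfun w (phi b) + wfun w (psi a) * (wfun w (phi b) - wfun w (psi b)) by ring.
  apply: le_trans (ler_normD _ _) _; rewrite !normrM.
  have h1 := wfun_lipschitz w (pe a); have h2 := wfun_lipschitz w (pe b).
  have := ler_pM (normr_ge0 _) (normr_ge0 _) h1 (wfun_le1 w (phi b)).
  have := ler_pM (normr_ge0 _) (normr_ge0 _) (wfun_le1 w (psi a)) h2.
  by lra.
rewrite sumr_const (card_gate_words R QS) -[X in X <= _]mulr_natl natrM natrX.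
by rewrite le_eqVlt; apply/orP; left; apply/eqP; ring.
Qed.

(** Here phi stands for the true data and psi for their grid points. Moving from phi to psi costs m
    times the entrywise error; at psi the diagonal gives the squared norm of v, and the rest is
    bounded by the Frobenius norm tau of the off-diagonal part. *)
Lemma gram_form_near (phi psi : 'I_m -> 'I_N -> R) (e tau : R) (v : 'I_m -> R) :
  (forall a n, `|phi a n - psi a n| <= e) -> 0 < tau ->
  \sum_a \sum_(b | b != a) gram Q psi a b ^+ 2 <= tau ^+ 2 ->
  `|\sum_a \sum_b v a * v b * gram Q phi a b - \sum_a v a ^+ 2|
    <= (tau + m%:R * (2 * 2 ^+ S * N%:R * e)) * \sum_a v a ^+ 2.
Proof.
move=> pe tau0 gtau; set W := \sum_a v a ^+ 2; set eps := 2 * _ * _ * e.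
have vW0 : 0 <= W by apply: sumr_ge0 => a _; rewrite sqr_ge0.
have d1 : `|\sum_a \sum_b v a * v b * gram Q phi a b - \sum_a \sum_b v a * v b * gram Q psi a b| <= m%:R * eps * W.
  rewrite -sumrB; apply: le_trans (ler_norm_sum _ _ _) _.
  apply: (@le_trans _ _ (\sum_(a < m) \sum_(b < m) (v a ^+ 2 + v b ^+ 2) / 2 * eps)).
    apply: ler_sum => a _; rewrite -sumrB; apply: le_trans (ler_norm_sum _ _ _) _.
    apply: ler_sum => b _; rewrite -mulrBr normrM; apply: ler_pM; rewrite ?normr_ge0//; last exact: gram_near.
    by rewrite normrM; have := amgm (v a) (v b) (@ltr01 R); rewrite invr1 !mul1r.
  have -> : \sum_(a < m) \sum_(b < m) (v a ^+ 2 + v b ^+ 2) / 2 * eps = m%:R * eps * W; last by [].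
  rewrite (eq_bigr (fun a => (m%:R * v a ^+ 2 + W) / 2 * eps)) => [|a _].
    rewrite -!mulr_suml big_split /= -mulr_sumr sumr_const card_ord -mulr_natl -/W; by field.
  by rewrite -!mulr_suml big_split /= sumr_const card_ord -[_ *+ m]mulr_natl.
suff d2 : `|\sum_a \sum_b v a * v b * gram Q psi a b - W| <= tau * W.
  rewrite mulrDl; apply: le_trans (lerD d2 d1).
  by rewrite [leRHS]addrC; exact: ler_distD.
have -> : \sum_a \sum_b v a * v b * gram Q psi a b - W = \sum_a \sum_(b | b != a) v a * v b * gram Q psi a b.
  rewrite /W -sumrB; apply: eq_bigr => a _.
  by rewrite (bigD1 a) //= (gram_diag Q0) mulr1 expr2 [LHS]addrC addKr.
(* The weight tau / W used below requires W to be nonzero. *)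
have [W0|Wn0] := eqVneq W 0.
  have v0 a : v a = 0.
    have /psumr_eq0P h : W = 0 by []; have := h (fun a _ => sqr_ge0 (v a)) a isT.
    by move/eqP; rewrite sqrf_eq0 => /eqP.
  by rewrite big1 ?normr0 ?W0 ?mulr0// => a _; rewrite big1// => b _; rewrite v0 !mul0r.
have Wp : 0 < W by rewrite lt_def Wn0.
apply: le_trans (ler_norm_sum _ _ _) _.
(* Cauchy-Schwarz through [amgm]: the weight tau / W makes each of the two halves at most tau W /
   2. *)
apply: (@le_trans _ _ (\sum_a \sum_(b | b != a)
   (tau / W * (v a ^+ 2 * v b ^+ 2) + W / tau * gram Q psi a b ^+ 2) / 2)).
  apply: ler_sum => a _; apply: le_trans (ler_norm_sum _ _ _) _; apply: ler_sum => b _.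
  rewrite normrM; have := amgm (v a * v b) (gram Q psi a b) (divr_gt0 tau0 Wp).
  by rewrite invf_div [(v a * v b) ^+ 2]exprMn.
rewrite (eq_bigr (fun a => tau / W / 2 * \sum_(b | b != a) (v a ^+ 2 * v b ^+ 2)
    + W / tau / 2 * \sum_(b | b != a) gram Q psi a b ^+ 2)) => [|a _]; last first.
  by rewrite !mulr_sumr -big_split; apply: eq_bigr => b _ /=; ring.
rewrite big_split /= -!mulr_sumr.
have -> : tau * W = tau / W / 2 * W ^+ 2 + W / tau / 2 * tau ^+ 2 by field; rewrite !gt_eqF.
have c1 : 0 <= tau / W / 2 by rewrite !divr_ge0// ltW.
have c2 : 0 <= W / tau / 2 by rewrite !divr_ge0// ltW.
apply: lerD; last exact: ler_wpM2l.
apply: ler_wpM2l => //.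
rewrite /W [X in _ <= X]expr2 mulr_suml; apply: ler_sum => a _.
rewrite mulr_sumr [leRHS](bigD1 a) //= lerDr mulr_ge0 ?sqr_ge0//.
Qed.

Section Count.
Variable L : nat.
Hypothesis L0 : (0 < L)%N.
Local Notation M := (4 * L)%N.

Definition good_configs (tau : R) : {set {ffun 'I_m * 'I_N -> 'I_M}} :=
  finset.finset (fun c => \sum_a \sum_(b | b != a) gram Q (@gridphi R N m L c) a b ^+ 2 <= tau ^+ 2).

(** Markov's inequality for the counting measure, with the second moments of [sum_config_gram]. *)
Lemma card_good_configs (tau : R) : 0 < tau ->
  1 - m%:R ^+ 2 * (2^-1 ^+ S / #|Q|%:R) / tau ^+ 2 <= #|good_configs tau|%:R / M%:R ^+ (m * N).
Proof.
move=> tau0; set G := good_configs tau.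
have t2 : 0 < tau ^+ 2 by rewrite exprn_gt0.
have M0 : 0 < (M%:R : R) ^+ (m * N) by rewrite exprn_gt0// ltr0n muln_gt0.
have tot : #|G|%:R + #|~: G|%:R = M%:R ^+ (m * N) :> R.
  by rewrite -natrD cardsC card_ffun card_prod !card_ord natrX.
have bad : #|~: G|%:R * tau ^+ 2 <= m%:R ^+ 2 * (M%:R ^+ (m * N) * (2^-1 ^+ S / #|Q|%:R)).
  have -> : #|~: G|%:R * tau ^+ 2 = \sum_(c in ~: G) tau ^+ 2 by rewrite sumr_const mulr_natl.
  apply: (@le_trans _ _ (\sum_c \sum_a \sum_(b | b != a) gram Q (@gridphi R N m L c) a b ^+ 2)).
    rewrite big_mkcond; apply: ler_sum => c _; case: ifP => [|_].
      by rewrite !inE -ltNge => /ltW.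
    by apply: sumr_ge0 => a _; apply: sumr_ge0 => b _; rewrite sqr_ge0.
  rewrite exchange_big /=.
  apply: (@le_trans _ _ (\sum_(a < m) \sum_(b < m) (M%:R ^+ (m * N) * (2^-1 ^+ S / #|Q|%:R)))).
    apply: ler_sum => a _; rewrite exchange_big /= [leLHS]big_mkcond; apply: ler_sum => b _.
    case: ifP => ba; last by rewrite mulr_ge0 ?(ltW M0)// divr_ge0 ?exprn_ge0 ?invr_ge0.
    by rewrite (sum_config_gram R Q0 QS L0)// eq_sym.
  by rewrite !sumr_const card_ord -mulrnA -[_ *+ (m * m)]mulr_natl [(m * m)%:R]natrM -expr2.
rewrite ler_pdivlMr// mulrBl mul1r -tot lerBlDr lerD2l.
rewrite mulrAC ler_pdivlMr// tot; apply: le_trans bad _.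
by rewrite le_eqVlt; apply/orP; left; apply/eqP; ring.
Qed.
End Count.
End GoodData.

(** * Eigenvalues and quadratic forms of real symmetric matrices *)

Section QuadraticForms.
Variables (R : realType) (m : nat).
Local Open Scope complex_scope.
Local Open Scope sesquilinear_scope.
Local Notation C := (R[i]).
Implicit Types (K : 'M[R]_m) (v : 'rV[R]_m).

Definition qform K v : R := \sum_a \sum_b v 0 a * v 0 b * K a b.

Definition sqnorm v : R := \sum_a v 0 a ^+ 2.

Lemma qformE K v : qform K v = (v *m K *m v^T) 0 0.
Proof.
rewrite /qform exchange_big [RHS]mxE; apply: eq_bigr => b _.
by rewrite !mxE mulr_suml; apply: eq_bigr => a _; rewrite mulrAC.
Qed.

Lemma sqnorm_gt0 v : v != 0 -> 0 < sqnorm v.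
Proof.
move=> v0; rewrite lt_def sumr_ge0 ?andbT => [|a _]; last exact: sqr_ge0.
apply: contraNneq v0 => /psumr_eq0P h; apply/eqP/rowP => a; rewrite mxE.
by have /eqP := h (fun a _ => sqr_ge0 (v 0 a)) a isT; rewrite sqrf_eq0 => /eqP.
Qed.

Lemma eigenvalue_bounds K (lo hi lambda : R) :
  (forall v, lo * sqnorm v <= qform K v <= hi * sqnorm v) ->
  eigenvalue K lambda -> lo <= lambda <= hi.
Proof.
move=> h /eigenvalueP[v vK /sqnorm_gt0 v0].
have := h v; rewrite qformE vK -scalemxAl mxE.
have -> : (v *m v^T) 0 0 = sqnorm v by rewrite mxE; apply: eq_bigr => a _; rewrite mxE expr2.
by rewrite !ler_pM2r.
Qed.

(** Converse of [eigenvalue_bounds], used for measurability. The complexified matrix is Hermitian,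
    so it has a unitary diagonalization with real entries, and these are eigenvalues of [K] itself;
    in the rotated coordinates the form is a weighted sum of squared moduli. *)
Lemma qform_bounds K (lo hi : R) : K^T = K ->
  (forall lambda, eigenvalue K lambda -> lo <= lambda <= hi) ->
  forall v, lo * sqnorm v <= qform K v <= hi * sqnorm v.
Proof.
move=> KT h v.
pose f := @real_complex R; pose Kc : 'M[C]_m := map_mx f K.
have Kh : Kc \is hermsymmx.
  apply: realsym_hermsym.
    apply/is_hermitianmxP; rewrite expr0 scale1r map_mx_id//.
    by rewrite /Kc map_trmx KT.
  by apply/mxOverP => i j; rewrite mxE complex_real.
pose P := spectralmx Kc; pose sp := spectral_diag Kc.
have Pu : P \is unitarymx by exact: spectral_unitarymx.
have Pi : invmx P = P^t* by exact: invmx_unitary.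
have Punit : P \in unitmx by exact: spectral_unit.
have KcE : Kc = invmx P *m diag_mx sp *m P by exact/orthomx_spectralP/hermitian_normalmx.
have rowP0 i : row i P != 0.
  apply/eqP => h0; have := congr1 (fun u : 'rV_m => (u *m invmx P) 0 i) h0.
  by rewrite -row_mul mulmxV// mul0mx !mxE eqxx => /eqP; rewrite oner_eq0.
have spE i : exists2 l : R, sp 0 i = l%:C & lo <= l <= hi.
  have := RIm_real (mxOverP (hermitian_spectral_diag_real Kh) 0 i).
  rewrite -/sp => Im0; exists (complex.Re (sp 0 i)).
    by move: Im0; case: (sp 0 i) => x y /= [->].
  apply: h; rewrite -(eigenvalue_map f) -/Kc.
  rewrite [X in eigenvalue _ X](_ : _ = sp 0 i); last by move: Im0; case: (sp 0 i) => x y /= [->].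
  apply/eigenvalueP; exists (row i P) => //.
  rewrite -row_mul [X in P *m X]KcE !mulmxA mulmxV// mul1mx row_mul row_diag_mx.
  by rewrite -scalemxAl -rowE.
pose vc : 'rV[C]_m := map_mx f v; pose u := vc *m P^t*.
have vcr : vc^T = vc^t*.
  by apply/matrixP => i j; rewrite !mxE /f /=; apply/eqP; rewrite eq_complex /= oppr0 !eqxx.
have uE : P *m vc^T = u^t*.
  by rewrite /u trmx_mul map_mxM trmxCK -vcr.
have PP : P^t* *m P = 1%:M by rewrite -Pi mulVmx.
have qE : (qform K v)%:C = \sum_i sp 0 i * (sqmod (u 0 i))%:C.
  have -> : (qform K v)%:C = (vc *m Kc *m vc^T) 0 0.
    by rewrite qformE /vc /Kc map_trmx -!map_mxM [RHS]mxE.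
  rewrite KcE Pi !mulmxA -/u -mulmxA uE mxE; apply: eq_bigr => i _.
  by rewrite mul_mx_diag !mxE sqmodE mulrAC mulrC.
have nE : (sqnorm v)%:C = \sum_i (sqmod (u 0 i))%:C.
  have -> : (sqnorm v)%:C = (vc *m vc^T) 0 0.
    by rewrite mxE rmorph_sum; apply: eq_bigr => a _; rewrite !mxE -rmorphM expr2.
  have -> : vc *m vc^T = u *m u^t* by rewrite -uE /u -mulmxA [P^t* *m _]mulmxA PP mul1mx.
  rewrite mxE; apply: eq_bigr => i _.
  by rewrite !mxE sqmodE.
have inj : injective (fun x : R => x%:C) by move=> x y [].
have spE' i : exists x, sp 0 i = x%:C /\ lo <= x <= hi.
  by have [x x1 x2] := spE i; exists x.
have [l lP] := choice spE'.
have {}qE : qform K v = \sum_i l i * sqmod (u 0 i).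
  apply: inj; rewrite qE rmorph_sum; apply: eq_bigr => i _.
  by rewrite (proj1 (lP i)) rmorphM.
have {}nE : sqnorm v = \sum_i sqmod (u 0 i) by apply: inj; rewrite nE rmorph_sum.
rewrite qE nE !mulr_sumr; apply/andP; split; apply: ler_sum => i _;
  by apply: ler_wpM2r (sqmod_ge0 _) _ _ _; case/andP: (proj2 (lP i)).
Qed.

(* Reduces an event about eigenvalues to countably many measurable conditions. *)
Lemma qform_ge0_ratr (g : 'rV[R]_m -> R) : continuous g ->
  (forall q : 'rV[rat]_m, 0 <= g (map_mx ratr q)) -> forall v, 0 <= g v.
Proof.
move=> gc gq v; rewrite leNgt; apply/negP => gv.
have : \forall w \near v, g w < 0.
  have /cvgrPdist_lt/(_ (- g v)) := gc v; rewrite oppr_gt0 => /(_ gv).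
  by apply: filterS => w; rewrite ltr_norml; lra.
move=> /nbhs_ballP[e /= e0 he].
have eq i : exists x : rat, v 0 i - e < ratr x < v 0 i + e.
  have [|x] := @rat_in_itvoo R (v 0 i - e) (v 0 i + e); first by lra.
  by rewrite in_itv /=; exists x.
have [q qP] := choice eq.
have hb : ball v e (map_mx ratr (\row_i q i)).
  split => // i j; rewrite !mxE ord1 -ball_normE /= ltr_norml.
  by have /andP[h1 h2] := qP j; apply/andP; split; lra.
by have := he _ hb; rewrite ltNge gq.
Qed.

Lemma continuous_sumr (I : Type) (r : seq I) (U : topologicalType) (F : I -> U -> R) :
  (forall i, continuous (F i)) -> continuous (fun u => \sum_(i <- r) F i u).
Proof.
move=> Fc; elim: r => [|i r IH].
  by under eq_fun do rewrite big_nil; move=> u; exact: cvg_cst.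
under eq_fun do rewrite big_cons; move=> u.
by apply: cvgD; [exact: Fc | exact: IH].
Qed.

Lemma continuous_mulr (U : topologicalType) (f g : U -> R) :
  continuous f -> continuous g -> continuous (fun u => f u * g u).
Proof. by move=> fc gc u; apply: cvgM; [exact: fc | exact: gc]. Qed.

Lemma continuous_subr (U : topologicalType) (f g : U -> R) :
  continuous f -> continuous g -> continuous (fun u => f u - g u).
Proof. by move=> fc gc u; apply: cvgB; [exact: fc | exact: gc]. Qed.

Lemma continuous_qform K : continuous (qform K).
Proof.
have cc a : continuous (fun v : 'rV[R]_m => v 0 a) by exact: coord_continuous.
apply: continuous_sumr => a; apply: continuous_sumr => b.
apply: continuous_mulr; last exact: cst_continuous.
exact: continuous_mulr.
Qed.

Lemma continuous_sqnorm (c : R) : continuous (fun v => c * sqnorm v).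
Proof.
have cc a : continuous (fun v : 'rV[R]_m => v 0 a) by exact: coord_continuous.
apply: continuous_mulr; first exact: cst_continuous.
by apply: continuous_sumr => a; under eq_fun do rewrite expr2; apply: continuous_mulr.
Qed.

End QuadraticForms.

(** * Measurability of the eigenvalue event *)

Section EigenvalueEvent.
Context {R : realType} {disp : measure_display} {T : measurableType disp}.
Variables (m : nat) (K : T -> 'M[R]_m) (lo hi : R).
Hypothesis KT : forall t, (K t)^T = K t.
Hypothesis mK : forall a b, measurable_fun setT (fun t => K t a b).

Lemma measurable_eigenvalue_event :
  measurable [set t | forall lambda, eigenvalue (K t) lambda -> lo <= lambda <= hi].
Proof.
pose w q : 'rV[R]_m := map_mx ratr q.
pose E (q : 'rV[rat]_m) := [set t | lo * sqnorm (w q) <= qform (K t) (w q)]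
   `&` [set t | qform (K t) (w q) <= hi * sqnorm (w q)].
(* [unpickle] enumerates the rational vectors; an index that decodes to none imposes no
   condition. *)
have -> : [set t | forall lambda, eigenvalue (K t) lambda -> lo <= lambda <= hi] =
    \bigcap_(i in setT) (if unpickle i is Some q then E q else setT).
  apply/seteqP; split => t /=.
    move=> h i _; case: (unpickle i) => // q.
    by have /andP[h1 h2] := qform_bounds (KT t) h (w q).
  move=> h lambda; apply: eigenvalue_bounds => v.
  have hq q : E q t by have := h (pickle q) Logic.I; rewrite pickleK.
  apply/andP; split; rewrite -subr_ge0; move: v; apply: qform_ge0_ratr.
  - by apply: continuous_subr; [exact: continuous_qform | exact: continuous_sqnorm].
  - by move=> q; rewrite subr_ge0; case: (hq q).
  - by apply: continuous_subr; [exact: continuous_sqnorm | exact: continuous_qform].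
  - by move=> q; rewrite subr_ge0; case: (hq q).
apply: bigcapT_measurable => i; case: (unpickle i) => // q.
have mq : measurable_fun setT (fun t => qform (K t) (w q)).
  apply: measurable_sum => a; apply: measurable_sum => b.
  by apply: measurable_realfun.measurable_funM => //; exact: mK.
apply: measurableI.
  by rewrite -[X in measurable X]setTI; apply: measurable_fun_le.
by rewrite -[X in measurable X]setTI; apply: measurable_fun_le.
Qed.

End EigenvalueEvent.

(** * Bounds on the kernel for a balanced circuit *)

Lemma qntk_sym (R : realType) N D m (o : 'cV[R]_N) (w : 'I_D -> word N) (x : 'I_m -> 'I_N -> R) theta :
  (qntk o w x theta)^T = qntk o w x theta.
Proof. by rewrite /qntk linearZ /= trmx_mul trmxK. Qed.

Section KernelForm.
Variables (R : realType) (N m D S : nat) (Q : {set {set 'I_N}}) (o : 'cV[R]_N).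
Hypothesis Q0 : Q != finset.set0.
Hypothesis QS : forall s, s \in Q -> #|s| = S.
Hypothesis S0 : (0 < S)%N.
Hypothesis D0 : (0 < D)%N.
Variables (f : {ffun 'I_D -> word N}) (x : 'I_m -> 'I_N -> R).
Local Notation phi := (fun a n => pi * x a n).
Local Notation K := (qntk o f x 0).

Lemma qform_qntk (v : 'rV[R]_m) :
  qform K v = D%:R^-1 * \sum_d (\sum_a v 0 a * wgrad o (f d) (phi a)) ^+ 2.
Proof.
rewrite /qntk qjacobianE mulr_sumr.
transitivity (\sum_a \sum_b \sum_d D%:R^-1 * ((v 0 a * wgrad o (f d) (phi a)) * (v 0 b * wgrad o (f d) (phi b)))).
  apply: eq_bigr => a _; apply: eq_bigr => b _.
  by rewrite !mxE !mulr_sumr; apply: eq_bigr => d _; rewrite !mxE; ring.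
under eq_bigr do rewrite exchange_big /=.
rewrite exchange_big /=; apply: eq_bigr => d _.
rewrite expr2 mulr_suml mulr_sumr; apply: eq_bigr => a _.
by rewrite !mulr_sumr.
Qed.

Lemma sum_occ (A : {set word N}) (F : word N -> R) : f \in ffun_on (mem A) ->
  \sum_d F (f d) = \sum_(w in A) (occ f w)%:R * F w.
Proof.
move=> /ffun_onP fA; under [RHS]eq_bigr do rewrite /occ natr_sum mulr_suml.
rewrite exchange_big; apply: eq_bigr => d _ /=.
rewrite (bigD1 (f d)) //= eqxx mul1r.
by rewrite big1 ?addr0// => w /andP[_ /negbTE wf]; rewrite eq_sym wf mul0r.
Qed.

(** Three comparisons in a row: balanced counts replace the gates by the uniform average over words,
    [form_bounds] replaces J_w by T_w support by support, and the assumption on [gram] replaces the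
    T_w form by the squared norm. *)
Lemma qform_qntk_bounds (eta rho : R) (v : 'rV[R]_m) : 0 <= eta <= 1 ->
  f \in balanced (gate_words Q) D eta ->
  `|\sum_a \sum_b v 0 a * v 0 b * gram Q phi a b - sqnorm v| <= rho * sqnorm v ->
  0 <= Delta S o ->
  (1 - eta) * (1 - rho) * (Delta S o / 2 ^+ S) * sqnorm v <= qform K v
    <= (1 + eta) * (1 + rho) * (absum o ^+ 2 / 2 ^+ S) * sqnorm v.
Proof.
move=> /andP[eta0 eta1]; rewrite inE => /andP[fA /forall_inP fb] gr De0.
pose q w := (\sum_a v 0 a * wgrad o w (phi a)) ^+ 2.
pose T w := (\sum_a v 0 a * wfun w (phi a)) ^+ 2.
pose xc := (#|gate_words Q|%:R : R).
have Qp : 0 < #|Q|%:R :> R by rewrite ltr0n card_gt0.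
have p2 : 0 < (2 : R) ^+ S by rewrite exprn_gt0.
have xcE : xc = #|Q|%:R * 2 ^+ S by rewrite /xc (card_gate_words R QS) natrM natrX.
have xc0 : 0 < xc by rewrite xcE mulr_gt0.
have Dp : 0 < D%:R :> R by rewrite ltr0n.
have Di : 0 < D%:R^-1 :> R by rewrite invr_gt0.
have qE : qform K v = D%:R^-1 * \sum_(w in gate_words Q) (occ f w)%:R * q w.
  by rewrite qform_qntk (sum_occ q fA).
have q0 w : 0 <= q w by exact: sqr_ge0.
(* Balance places each weight n_w / D between (1 - eta) / xc and (1 + eta) / xc. *)
have /andP[lo hi] : (1 - eta) / xc * (\sum_(w in gate_words Q) q w) <= qform K v
    <= (1 + eta) / xc * (\sum_(w in gate_words Q) q w).
  rewrite qE !mulr_sumr; apply/andP; split; apply: ler_sum => w wA;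
    have := fb w wA; rewrite -/xc ler_norml => /andP[h1 h2].
    rewrite [X in _ <= X]mulrA; apply: ler_wpM2r => //.
    have := ler_wpM2l (ltW Di) h1.
    have -> : D%:R^-1 * - (eta * (D%:R / xc)) = - (eta / xc) by field; rewrite !gt_eqF.
    have -> : D%:R^-1 * ((occ f w)%:R - D%:R / xc) = D%:R^-1 * (occ f w)%:R - xc^-1 by field; rewrite !gt_eqF.
    by rewrite mulrBl mul1r; lra.
  rewrite [X in X <= _]mulrA; apply: ler_wpM2r => //.
  have := ler_wpM2l (ltW Di) h2.
  have -> : D%:R^-1 * (eta * (D%:R / xc)) = eta / xc by field; rewrite !gt_eqF.
  have -> : D%:R^-1 * ((occ f w)%:R - D%:R / xc) = D%:R^-1 * (occ f w)%:R - xc^-1 by field; rewrite !gt_eqF.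
  by rewrite mulrDl mul1r; lra.
have /andP[qlo qhi] : Delta S o * (\sum_(w in gate_words Q) T w) <= \sum_(w in gate_words Q) q w
    <= absum o ^+ 2 * (\sum_(w in gate_words Q) T w).
  rewrite !sum_gate_words !mulr_sumr; apply/andP; split; apply: ler_sum => s sQ;
    by have /andP[] := form_bounds o (fun a n => pi * x a n) (fun a => v 0 a) (QS sQ) S0.
have gE := gram_form Q (fun a n => pi * x a n) (fun a => v 0 a).
move: gr; rewrite gE -/(sqnorm v) ler_norml => /andP[g1 g2].
set ST := \sum_(w in _) T w in qlo qhi; rewrite -/ST in g1 g2.
pose G := #|Q|%:R^-1 * ST.
have STE c : c / xc * ST = c / 2 ^+ S * G by rewrite /G xcE; field; rewrite !gt_eqF.
apply/andP; split.
  apply: le_trans lo; apply: (@le_trans _ _ ((1 - eta) / xc * (Delta S o * ST))); last first.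
    by apply: ler_wpM2l => //; rewrite divr_ge0 ?subr_ge0// ltW.
  have -> : (1 - eta) / xc * (Delta S o * ST) = ((1 - eta) * Delta S o) / xc * ST by ring.
  rewrite STE.
  have -> : (1 - eta) * (1 - rho) * (Delta S o / 2 ^+ S) * sqnorm v
    = (1 - eta) * Delta S o / 2 ^+ S * ((1 - rho) * sqnorm v) by ring.
  apply: ler_wpM2l; first by rewrite divr_ge0 ?mulr_ge0 ?subr_ge0// ltW.
  by rewrite /G mulrBl mul1r; lra.
apply: (le_trans hi); apply: (@le_trans _ _ ((1 + eta) / xc * (absum o ^+ 2 * ST))).
  by apply: ler_wpM2l => //; rewrite divr_ge0 ?addr_ge0// ltW.
have -> : (1 + eta) / xc * (absum o ^+ 2 * ST) = ((1 + eta) * absum o ^+ 2) / xc * ST by ring.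
rewrite STE.
have -> : (1 + eta) * (1 + rho) * (absum o ^+ 2 / 2 ^+ S) * sqnorm v
  = (1 + eta) * absum o ^+ 2 / 2 ^+ S * ((1 + rho) * sqnorm v) by ring.
apply: ler_wpM2l; first by rewrite divr_ge0 ?(ltW p2)// mulr_ge0 ?addr_ge0 ?sqr_ge0.
by rewrite /G mulrDl mul1r; lra.
Qed.
End KernelForm.

(** * Probabilities of the circuit and data events *)

Section RandomSources.
Context {R : realType} {disp : measure_display} {T : measurableType disp}.
Variable P : probability T R.
Variables (m N D S : nat) (Q : {set {set 'I_N}}).
Variables (X : 'I_m -> 'I_N -> {RV P >-> R}) (W : 'I_D -> T -> word N).
Hypothesis Q0 : Q != finset.set0.
Hypothesis QS : forall s, s \in Q -> #|s| = S.
Hypothesis Xu : forall a n, uniform_on_m1_1 (X a n).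
Hypothesis mW : forall d, measurable_word (W d).
Hypothesis Wl : forall d, gate_law P Q S (W d).
Hypothesis ind : mutually_independent P (sources X W).

Lemma sources_inhabited j : exists B, sources X W j B.
Proof.
case: j => [[a n]|d]; first by exists (X a n @^-1` setT); exists setT => //; exact: measurableT.
by exists (W d @^-1` setT); exists setT.
Qed.

Definition circuit_event (good : {set {ffun 'I_D -> word N}}) : set T :=
  \bigcup_(f in [set` good]) \bigcap_(d in setT) (W d @^-1` [set f d]).

Lemma measurable_circuit_event good : measurable (circuit_event good).
Proof. by apply: (measurable_configurations (Ev := fun d w => W d @^-1` [set w])) => d w; exact: mW. Qed.

(** The law 1 / |Q| of the support times 2^-S for its letters makes a gate uniform on
    [gate_words Q], so probabilities reduce to counting. *)
Lemma probability_circuit_event (good : {set {ffun 'I_D -> word N}}) :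
  {subset good <= ffun_on (mem (gate_words Q))} ->
  P (circuit_event good) = (#|good|%:R / #|gate_words Q|%:R ^+ D)%:E.
Proof.
move=> gQ; rewrite -[D in _ ^+ D]card_ord.
apply: (@probability_configurations R _ T P _ (sources X W) _ _ (@inr _ _) (fun d w => W d @^-1` [set w])) => //.
- by move=> d d' [].
- by move=> d w; exists [set w].
- exact: sources_inhabited.
- by move=> d u v uv; rewrite -subset0 => t [/= -> uv']; move: uv; rewrite uv' eqxx.
move=> d w; rewrite inE => wQ; have [l1 l2] := Wl d.
rewrite -[X in P X]/([set t | W d t = w]) l2// l1// -EFinM (card_gate_words R QS) natrM natrX.
by rewrite invfM.
Qed.

Variable L : nat.
Hypothesis L0 : (0 < L)%N.
Local Notation M := (4 * L)%N.

(** Half-open, so that distinct cells are disjoint. *)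
Definition grid_cell (j : 'I_M) : set R := `[gridpt R L j, gridpt R L j.+1[%classic.

Lemma uniform_grid_cell j : uniform_prob (ltN11 R) (grid_cell j) = (M%:R^-1)%:E.
Proof.
have M0 : 0 < M%:R :> R by rewrite ltr0n muln_gt0.
have jM : (j.+1%:R : R) <= M%:R by rewrite ler_nat ltn_ord.
have sub : grid_cell j `<=` `[-1, 1]%classic.
  move=> x; rewrite /grid_cell /= !in_itv /= /gridpt => /andP[h1 h2].
  have := ler_wpM2r (ltW (_ : 0 < M%:R^-1)) jM; rewrite invr_gt0 mulfV ?gt_eqF// => /(_ M0) h3.
  have h4 : 0 <= j%:R / M%:R :> R by rewrite divr_ge0.
  by apply/andP; split; lra.
rewrite /uniform_prob (eq_integral (fun=> (2^-1)%:E)) => [|x]; last first.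
  rewrite inE => /sub; rewrite /= in_itv /= /uniform_pdf => ->.
  by congr ((_^-1)%:E); ring.
rewrite integral_cst; last exact: measurable_itv.
rewrite [X in (_ * X)%E](lebesgue_measure_itv `[gridpt R L j, gridpt R L j.+1[) /= lte_fin.
have e : gridpt R L j.+1 - gridpt R L j = 2 / M%:R by rewrite /gridpt -[j.+1%:R]natr1; field; rewrite pnatr_eq0 -lt0n.
have -> : gridpt R L j < gridpt R L j.+1 by rewrite -subr_gt0 e divr_gt0.
by rewrite -EFinB e -EFinM mulrA mulVf// mul1r.
Qed.

Lemma measurable_grid_cell j : measurable (grid_cell j).
Proof. exact: measurable_itv. Qed.

Definition data_event (good : {set {ffun 'I_m * 'I_N -> 'I_M}}) : set T :=
  \bigcup_(c in [set` good]) \bigcap_(p in setT) (X p.1 p.2 @^-1` grid_cell (c p)).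

Let mX p j : measurable (X p.1 p.2 @^-1` grid_cell j).
Proof. by rewrite -[X in measurable X]setTI; apply: measurable_funPT => //; exact: measurable_grid_cell. Qed.

Lemma measurable_data_event good : measurable (data_event good).
Proof. exact: (measurable_configurations (Ev := fun p j => X p.1 p.2 @^-1` grid_cell j)). Qed.

Lemma grid_cell_disjoint i j : i != j -> grid_cell i `&` grid_cell j = set0.
Proof.
have M0 : 0 < M%:R :> R by rewrite ltr0n muln_gt0.
have lt (u v : 'I_M) x : grid_cell u x -> grid_cell v x -> (u <= v)%N.
  rewrite /grid_cell /= !in_itv /= /gridpt => /andP[a1 a2] /andP[b1 b2].
  rewrite -ltnS -(ltr_nat R); have : u%:R / M%:R < v.+1%:R / M%:R :> R by lra.
  by rewrite ltr_pM2r ?invr_gt0.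
move=> ij; rewrite -subset0 => x [xi xj]; move: ij.
by rewrite -val_eqE eqn_leq (lt _ _ _ xi xj) (lt _ _ _ xj xi).
Qed.

Lemma probability_data_event (good : {set {ffun 'I_m * 'I_N -> 'I_M}}) :
  P (data_event good) = (#|good|%:R / M%:R ^+ (m * N))%:E.
Proof.
have -> : (m * N)%N = #|{: 'I_m * 'I_N}| by rewrite card_prod !card_ord.
have -> : (M%:R : R) = #|finset.setTfor 'I_M|%:R by rewrite cardsT card_ord.
apply: (@probability_configurations R _ T P _ (sources X W) _ _ (@inl _ _)
   (fun p j => X p.1 p.2 @^-1` grid_cell j)) => //.
- by move=> p q [].
- by case=> a n j; exists (grid_cell j) => //; exact: measurable_grid_cell.
- exact: sources_inhabited.
- by move=> p i j ij; rewrite -preimage_setI grid_cell_disjoint// preimage_set0.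
- move=> [a n] j _; rewrite cardsT card_ord -(uniform_grid_cell j) -(Xu a n)//.
  exact: measurable_grid_cell.
by move=> c _; apply/ffun_onP => p; rewrite inE.
Qed.

End RandomSources.

(** * Measurability of the kernel *)

Section KernelMeasurability.
Context {R : realType} {disp : measure_display} {T : measurableType disp}.

Lemma measurable_trigf c (h : T -> R) : measurable_fun setT h ->
  measurable_fun setT (fun t => trigf c (h t)).
Proof.
move=> mh; case: c => [[]|] /=.
- by apply: (measurableT_comp _ mh); apply: measurable_realfun.continuous_measurable_fun; exact: continuous_sin.
- by apply: (measurableT_comp _ mh); apply: measurable_realfun.continuous_measurable_fun; exact: continuous_cos.
exact: measurable_cst.
Qed.

Lemma measurable_ndtrigf c (h : T -> R) : measurable_fun setT h ->
  measurable_fun setT (fun t => ndtrigf c (h t)).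
Proof.
move=> mh; case: c => [[]|] /=; last exact: measurable_cst.
- by apply: measurable_realfun.measurable_funN; exact: (measurable_trigf (Some false) mh).
- exact: (measurable_trigf (Some true) mh).
Qed.

Variables (m N D : nat) (o : 'cV[R]_N) (X : 'I_m -> 'I_N -> T -> R) (W : 'I_D -> T -> word N).
Hypothesis mX : forall a n, measurable_fun setT (X a n).
Hypothesis mW : forall d, measurable_word (W d).

Lemma measurable_wgrad w a : measurable_fun setT (fun t => wgrad o w (fun n => pi * X a n t)).
Proof.
have mp n : measurable_fun setT (fun t => pi * X a n t).
  by apply: measurable_realfun.measurable_funM => //; exact: measurable_cst.
apply: measurable_sum => k; apply: measurable_realfun.measurable_funM; first exact: measurable_cst.
apply: measurable_realfun.measurable_funM; first exact: measurable_ndtrigf.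
under eq_fun do rewrite big_mkcond.
apply: measurable_prod => n _; case: (n != k); last exact: measurable_cst.
exact: measurable_trigf.
Qed.

(** The random word takes finitely many values: the function is split along their indicators, with
    the word fixed in each term. *)
Lemma measurable_gate_wgrad d a :
  measurable_fun setT (fun t => wgrad o (W d t) (fun n => pi * X a n t)).
Proof.
have -> : (fun t => wgrad o (W d t) (fun n => pi * X a n t)) =
    (fun t => \sum_w \1_(W d @^-1` [set w]) t * wgrad o w (fun n => pi * X a n t)).
  apply/funext => t; rewrite (bigD1 (W d t)) //= big1 ?addr0 => [|w wW].
    by rewrite indicE mem_set ?mul1r.
  by rewrite indicE memNset ?mul0r// => /= h; move: wW; rewrite h eqxx.
apply: measurable_sum => w; apply: measurable_realfun.measurable_funM; last exact: measurable_wgrad.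
by apply: measurable_realfun.measurable_indic; exact: mW.
Qed.

Lemma measurable_qntk a b :
  measurable_fun setT (fun t => qntk o (fun d => W d t) (fun a n => X a n t) 0 a b).
Proof.
under eq_fun do rewrite /qntk qjacobianE !mxE.
apply: measurable_realfun.measurable_funM; first exact: measurable_cst.
apply: measurable_sum => d; under eq_fun do rewrite !mxE.
by apply: measurable_realfun.measurable_funM; exact: measurable_gate_wgrad.
Qed.
Lemma measurable_qntk_event (lo hi : R) :
  measurable [set t | forall lambda : R,
    eigenvalue (qntk o (fun d => W d t) (fun a n => X a n t) 0) lambda -> lo <= lambda <= hi].
Proof.
apply: (@measurable_eigenvalue_event R disp T m
  (fun t => qntk o (fun d => W d t) (fun a n => X a n t) 0)); last exact: measurable_qntk.
move=> t; exact: qntk_sym.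
Qed.
End KernelMeasurability.

(** * Tail estimates and assembly *)

Section Assembly.
Variable R : realType.

Lemma probability_setI_ge (disp : measure_display) (T : measurableType disp)
    (P : probability T R) (A B : set T) (a b : R) :
  measurable A -> measurable B ->
  ((1 - a)%:E <= P A)%E -> ((1 - b)%:E <= P B)%E -> ((1 - (a + b))%:E <= P (A `&` B))%E.
Proof.
move=> mA mB hA hB.
have mI : measurable (A `&` B) by exact: measurableI.
have hU : (P (~` A `|` ~` B) <= P (~` A) + P (~` B))%E.
  by apply: measureU2; exact: measurableC.
move: hU.
have cA := probability_setC P mA; have cB := probability_setC P mB; have cI := probability_setC P mI.
rewrite -setCI cA cB cI.
move: hA hB; rewrite -(fineK (fin_num_measure P A mA)) -(fineK (fin_num_measure P B mB)).
rewrite -(fineK (fin_num_measure P _ mI)) -!EFinB -EFinD !lee_fin; lra.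
Qed.

Lemma near_grid (L N m : nat) (c : {ffun 'I_m * 'I_N -> 'I_(4 * L)}) a n (x : R) :
  (0 < L)%N -> grid_cell (c (a, n)) x ->
  `|pi * x - gridphi R c a n| <= 2 * pi / (4 * L)%:R.
Proof.
move=> L0; rewrite /grid_cell /= in_itv /= => /andP[h1 h2].
have e : gridpt R L (c (a, n)).+1 - gridpt R L (c (a, n)) = 2 / (4 * L)%:R.
  by rewrite /gridpt -[(c (a, n)).+1%:R]natr1; field; rewrite pnatr_eq0 -lt0n.
rewrite /gridphi -mulrBr normrM ger0_norm ?pi_ge0// [2 * pi]mulrC -mulrA.
by apply: ler_wpM2l; rewrite ?pi_ge0// -e ler_norml; apply/andP; split; lra.
Qed.

Lemma exists_mesh (B : R) (r : R) : 0 < r -> exists2 L : nat, (0 < L)%N & B / (4 * L)%:R <= r.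
Proof.
move=> r0; exists (Num.truncn (`|B| / r)).+1 => //.
rewrite ler_pdivrMr ?ltr0n// mulrC -ler_pdivrMr//.
have h := truncnS_gt (`|B| / r).
have h1 : B / r <= `|B| / r by rewrite ler_pM2r ?invr_gt0// ler_norm.
apply: le_trans h1 _; apply: le_trans (ltW h) _.
by rewrite ler_nat leq_pmull.
Qed.

(** exp (-1/2) >= 1/2, hence exp 1 <= 4. *)
Lemma ln4_ge1 (t : R) : 4 <= t -> 1 <= ln t.
Proof.
move=> t4; rewrite -ler_expR lnK ?posrE; last by lra.
apply: le_trans t4.
have h : expR (2^-1) <= 2 :> R.
  rewrite -[expR _]invrK -[X in _ <= X]invrK lef_pV2 ?posrE ?invr_gt0 ?expR_gt0//.
  by rewrite -expRN; have := expR_ge1Dx (- 2^-1 : R); lra.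
have -> : 1 = 2^-1 + 2^-1 :> R by lra.
by rewrite expRD; have := expR_gt0 (2^-1 : R); nra.
Qed.

Lemma circuit_tail (x k delta D D0 : R) : 0 < x -> 0 < k < 1 -> 0 < delta < 1 -> 1 <= x ->
  64 * x / k ^+ 2 <= D0 -> D0 * ln (D0 / delta) <= D ->
  2 * x * expR (- ((k / 4) ^+ 2 / 4 * (D / x))) <= delta / 2.
Proof.
move=> x0 /andP[k0 k1] /andP[d0 d1] x1 hD0 hD.
have k20 : 0 < k ^+ 2 by rewrite exprn_gt0.
have k21 : k ^+ 2 <= 1 by rewrite expr_le1// ltW.
have h4 : 64 * x <= 64 * x / k ^+ 2 by rewrite ler_pdivlMr// ler_piMr//; lra.
have D00 : 4 * x <= D0 by lra.
have pos : 0 < 4 * x / delta by rewrite divr_gt0//; lra.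
have l1 : ln (4 * x / delta) <= ln (D0 / delta).
  by rewrite ler_ln ?posrE//; [rewrite ler_pM2r ?invr_gt0 | rewrite divr_gt0//; lra].
have l0 : 0 <= ln (4 * x / delta) by rewrite ln_ge0// ler_pdivlMr//; lra.
have h5 : 64 * x / k ^+ 2 * ln (4 * x / delta) <= D.
  by apply: le_trans hD; apply: ler_pM => //; lra.
have h6 : ln (4 * x / delta) <= (k / 4) ^+ 2 / 4 * (D / x).
  have -> : ln (4 * x / delta) = (k ^+ 2 / (64 * x)) * (64 * x / k ^+ 2 * ln (4 * x / delta)).
    by field; rewrite !gt_eqF//.
  have -> : (k / 4) ^+ 2 / 4 * (D / x) = (k ^+ 2 / (64 * x)) * D by field; rewrite gt_eqF.
  by apply: ler_wpM2l h5; rewrite divr_ge0 ?ltW//; lra.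
have h7 : expR (- ((k / 4) ^+ 2 / 4 * (D / x))) <= delta / (4 * x).
  rewrite -[delta / _]lnK ?posrE ?divr_gt0//; last by lra.
  rewrite ler_expR -[delta / _]invf_div lnV ?posrE// lerN2; exact: h6.
have := ler_wpM2l (ltW (_ : 0 < 2 * x)) h7.
have -> : 2 * x * (delta / (4 * x)) = delta / 2 by field; rewrite gt_eqF.
by apply; lra.
Qed.

(** The summand 2 beside the logarithm turns the assumption into 2^S >= 4 Y. With ln m >= 1 this
    bounds the left side by delta^2 / 4, hence by delta / 2. *)
Lemma data_tail (m S q : nat) (k delta : R) : (4 <= m)%N -> (0 < q)%N -> 0 < k < 1 -> 0 < delta < 1 ->
  2 + log2 (8 ^+ 2 * m%:R ^+ 2 * ln m%:R / (k ^+ 2 * q%:R * delta ^+ 2)) <= S%:R ->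
  m%:R ^+ 2 * (2^-1 ^+ S / q%:R) / (k / 8) ^+ 2 <= delta / 2.
Proof.
move=> m4 q0' /andP[k0 k1] /andP[d0 d1].
have q0 : 0 < q%:R :> R by rewrite ltr0n.
have m4' : 4 <= m%:R :> R by rewrite (ler_nat R 4).
have lm := ln4_ge1 m4'.
set Y := _ / (k ^+ 2 * _ * _).
have Y0 : 0 < Y.
  by rewrite /Y divr_gt0 ?mulr_gt0 ?exprn_gt0//; lra.
have l2 : 0 < ln 2 :> R by rewrite ln_gt0 ?ltr1n.
rewrite /log2 => hS.
have hY : 4 * Y <= 2 ^+ S.
  have Y4 : 0 < 4 * Y by rewrite mulr_gt0.
  suff : ln (4 * Y) <= ln (2 ^+ S) by rewrite ler_ln ?posrE ?exprn_gt0.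
  rewrite lnM ?posrE// lnXn//.
  have -> : ln 4 = 2 * ln 2 :> R.
    have -> : 4 = 2 ^+ 2 :> R by ring.
    by rewrite lnXn// mulr_natl.
  rewrite -[leRHS]mulr_natl -ler_pdivrMr// mulrDl mulfK ?gt_eqF//.
have p2 : 0 < 2 ^+ S :> R by rewrite exprn_gt0.
have e1 : 4 * Y = 256 * (m%:R ^+ 2 / (k ^+ 2 * q%:R)) * ln m%:R / delta ^+ 2.
  by rewrite /Y; field; rewrite !gt_eqF//.
set Z := m%:R ^+ 2 / (k ^+ 2 * q%:R) in e1.
have Z0 : 0 < Z by rewrite divr_gt0 ?mulr_gt0 ?exprn_gt0//; lra.
have -> : m%:R ^+ 2 * (2^-1 ^+ S / q%:R) / (k / 8) ^+ 2 = 64 * Z / 2 ^+ S.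
  by rewrite exprVn /Z; field; rewrite !gt_eqF//.
rewrite ler_pdivrMr//.
have d2 : 0 < delta ^+ 2 by rewrite exprn_gt0.
have h1 : 256 * Z / delta ^+ 2 <= 2 ^+ S.
  apply: le_trans hY; rewrite e1 ler_pM2r ?invr_gt0//.
  by rewrite -[X in X <= _]mulr1 ler_pM2l//; lra.
have : 64 * Z <= delta / 2 * (256 * Z / delta ^+ 2).
  have -> : delta / 2 * (256 * Z / delta ^+ 2) = 128 * Z / delta by field; rewrite gt_eqF.
  rewrite ler_pdivlMr//; nra.
move=> h2; apply: le_trans h2 _.
by apply: ler_wpM2l => //; lra.
Qed.

End Assembly.

Theorem lemma2 (R : realType) :
  exists (m0 : nat) (C1 C2 : R), 0 < C1 /\ 0 < C2 /\
  forall (m N D S : nat) (Q : {set {set 'I_N}}) (o : 'cV[R]_N)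
    (disp : measure_display) (T : measurableType disp) (P : probability T R)
    (X : 'I_m -> 'I_N -> {RV P >-> R}) (W : 'I_D -> T -> word N)
    (delta k : R),
  (m0 <= m)%N ->
  Q != finset.set0 ->
  (forall s : {set 'I_N}, s \in Q -> #|s| = S) ->
  (forall a n, uniform_on_m1_1 (X a n)) ->
  (forall d, measurable_word (W d)) ->
  (forall d, gate_law P Q S (W d)) ->
  mutually_independent P (sources X W) ->
  0 < Delta S o ->
  0 < delta < 1 ->
  0 < k < 1 ->
  let normO := spectral_norm (observable o) in
  let D0 := C2 * (m%:R * normO ^+ 4 / (k ^+ 2 * Delta S o ^+ 2))
            * ln (m%:R / delta) in
  D0 * ln (D0 / delta) <= D%:R ->
  2 + log2 (C1 ^+ 2 * m%:R ^+ 2 * ln m%:R / (k ^+ 2 * #|Q|%:R * delta ^+ 2))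
    <= S%:R ->
  ((1 - delta)%:E <=
   P [set t | forall lambda : R,
        eigenvalue (qntk o (fun d => W d t) (fun a n => X a n t) 0) lambda ->
        ((1 - k) * (Delta S o / 2 ^+ S) <= lambda
          <= (1 + k) * (normO ^+ 2 / 2 ^+ S))%R])%E.
Proof.
(* m0 = 4 ensures ln m >= 1; C1 = 8 matches tau = k / 8; C2 = 64 * 16, with 64 from the Chernoff
   exponent and 16 from [card_words_ratio]. *)
exists 4%N, 8, 1024; split; first by rewrite ltr0n.
split; first by rewrite ltr0n.
move=> m N D S Q o disp T P X W delta k m4 Q0 QS Xu mW Wl ind De hdelta hk normO D0 hD hS.
have nE : normO = absum o by exact: spectral_normE.
rewrite nE in D0 hD *; clear normO nE.
have [/andP[d0 d1] /andP[k0 k1]] := (hdelta, hk).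
have S0 := support_size_gt0 De.
have m4' : 4 <= m%:R :> R by rewrite (ler_nat R 4).
have Q1 : (0 < #|Q|)%N by rewrite card_gt0.
pose x : R := #|gate_words Q|%:R.
have xE : x = 2 ^+ S * #|Q|%:R by rewrite /x (card_gate_words R QS) natrM natrX mulrC.
have x1 : 1 <= x by rewrite (ler_nat R 1) (card_gate_words R QS) muln_gt0 Q1 expn_gt0.
have k20 : 0 < k ^+ 2 by rewrite exprn_gt0.
(* D0 contains 64 * 16 y^4 / k^2, where y is the norm over sqrt Delta, and 16 y^4 bounds x; the
   remaining factor m ln (m / delta) is at least 1. *)
have D0x : 64 * x / k ^+ 2 <= D0.
  have De2 : 0 < Delta S o ^+ 2 by rewrite exprn_gt0.
  have y4 : x <= 16 * (absum o ^+ 4 / Delta S o ^+ 2).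
    have := card_words_ratio Q0 QS De; rewrite -xE => /le_trans; apply.
    by rewrite expr_div_n -[X in _ <= 16 * (_ / X ^+ 2)](sqr_sqrtr (ltW De)) -exprM.
  have l1 : 1 <= ln (m%:R / delta).
    by apply: ln4_ge1; rewrite ler_pdivlMr//; nra.
  have z0 : 0 <= 64 * x / k ^+ 2 by rewrite divr_ge0 ?ltW//; lra.
  have -> : D0 = 1024 * (absum o ^+ 4 / Delta S o ^+ 2) / k ^+ 2 * (m%:R * ln (m%:R / delta)).
    by rewrite /D0; field; rewrite !gt_eqF.
  apply: (@le_trans _ _ (64 * x / k ^+ 2 * 1)); first by rewrite mulr1.
  apply: ler_pM => //; last by nra.
  by rewrite ler_pM2r ?invr_gt0//; lra.
have Dp : (0 < D)%N.
  have : 0 < D0 * ln (D0 / delta).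
    have D01 : 1 < D0.
      by apply: lt_le_trans D0x; rewrite ltr_pdivlMr//; nra.
    by rewrite mulr_gt0 ?ln_gt0 ?ltr_pdivlMr//; lra.
  by move=> /lt_le_trans/(_ hD); rewrite ltr0n.
(* Errors of k / 4 from the counts and k / 4 from the Gram matrix combine, since (1 - k/4)^2 >= 1 -
   k and (1 + k/4)^2 <= 1 + k. *)
pose eta := k / 4.
have heta : 0 < eta <= 2^-1 by rewrite /eta; apply/andP; split; lra.
pose circuits := balanced (gate_words Q) D eta.
have PA : ((1 - delta / 2)%:E <= P (circuit_event W circuits))%E.
  rewrite (probability_circuit_event QS mW Wl ind); last by move=> f; rewrite inE => /andP[].
  rewrite lee_fin -/x.
  have xD : 0 < x ^+ D by rewrite exprn_gt0//; lra.
  rewrite ler_pdivlMr// mulrC; apply: le_trans (card_balanced (gate_words Q) D heta).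
  rewrite -/x ler_pM2l// lerD2l lerN2.
  by apply: circuit_tail hD => //; lra.
(* The mesh makes the discretization error of [gram_form_near] at most k / 8; with tau = k / 8 the
   total Gram error is k / 4. *)
pose B : R := m%:R * (2 * 2 ^+ S * N%:R * (2 * pi)).
have [L L0 hL] : exists2 L : nat, (0 < L)%N & B / (4 * L)%:R <= k / 8.
  by apply: exists_mesh; lra.
pose tau := k / 8.
have tau0 : 0 < tau by rewrite /tau; lra.
pose configs := @good_configs R N m Q L tau.
have PB : ((1 - delta / 2)%:E <= P (data_event X configs))%E.
  rewrite (probability_data_event Xu ind)// lee_fin.
  apply: le_trans (card_good_configs m Q0 QS L0 tau0).
  by rewrite lerD2l lerN2; apply: data_tail.
have mA := measurable_circuit_event mW circuits.
have mB := measurable_data_event X configs.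
have := probability_setI_ge mA mB PA PB.
have -> : delta / 2 + delta / 2 = delta by lra.
move=> /le_trans; apply; apply: le_measure; rewrite ?inE.
- exact: measurableI.
- apply: measurable_qntk_event => // a n; exact: measurable_funPT.
(* On both events the estimate is deterministic: [f] is the actual list of gate words, and [c] gives
   the grid cells that contain the data. *)
move=> t [[f fc fW] [c cc cX]] lambda.
have -> : (fun d => W d t) = f by apply/funext => d; exact: fW.
have gX a n : `|pi * X a n t - gridphi R c a n| <= 2 * pi / (4 * L)%:R.
  by apply: near_grid => //; exact: (cX (a, n)).
have De0 : 0 <= Delta S o by exact: ltW.
apply: eigenvalue_bounds => v.
have gt : \sum_a \sum_(b | b != a) gram Q (gridphi R c) a b ^+ 2 <= tau ^+ 2.
  by move: cc; rewrite /= inE.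
have near := gram_form_near Q0 QS (fun a => v 0 a) gX tau0 gt.
have heta' : 0 <= eta <= 1 by move: heta => /andP[h1 h2]; apply/andP; split; lra.
have rho : `|\sum_a \sum_b v 0 a * v 0 b * gram Q (fun a n => pi * X a n t) a b - sqnorm v| <= k / 4 * sqnorm v.
  apply: le_trans near _; rewrite ler_wpM2r ?sumr_ge0// => [a _|]; first exact: sqr_ge0.
  have -> : m%:R * (2 * 2 ^+ S * N%:R * (2 * pi / (4 * L)%:R)) = B / (4 * L)%:R :> R.
    by rewrite /B -!mulrA.
  by rewrite /tau; lra.
have /andP[h1 h2] := qform_qntk_bounds Q0 QS S0 Dp heta' fc rho De0.
have v0 : 0 <= sqnorm v by apply: sumr_ge0 => a _; exact: sqr_ge0.
have p2 : 0 < 2 ^+ S :> R by rewrite exprn_gt0.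
apply/andP; split.
  apply: le_trans h1; apply: ler_wpM2r => //; apply: ler_wpM2r; first by rewrite divr_ge0 ?ltW.
  by rewrite /eta; nra.
apply: (le_trans h2); apply: ler_wpM2r => //; apply: ler_wpM2r; first by rewrite divr_ge0 ?sqr_ge0 ?ltW.
by rewrite /eta; nra.
Qed.
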